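(* Let $n\ge 1$. The hypersurface $H^n\left(\tfrac{1}{\sqrt2}\right)$, embedded in the anti de Sitter space $H^{n+1}_1(1)$ by $y\mapsto\left(y,\tfrac1{\sqrt2}\right)$, is a proper biharmonic space-like hypersurface of $H^{n+1}_1(1)$.
   Context: Let $R^{n+2}_2$ be $\mathbb{R}^{n+2}$ with the indefinite scalar product $\langle x,x\rangle=x_1^2+\cdots+x_n^2-x_{n+1}^2-x_{n+2}^2$. The anti de Sitter (ADS) space is $H^{n+1}_1(1)=\{x\in R^{n+2}_2:\langle x,x\rangle=-1\}$ with the induced metric (index $1$, constant sectional curvature $-1$). For $r>0$, $H^n(r)$ is the connected component through $(0,\ldots,0,r)$ of $\{y\in\mathbb{R}^{n+1}: y_1^2+\cdots+y_n^2-y_{n+1}^2=-r^2\}$, with the (Riemannian) metric induced from the form $y_1^2+\cdots+y_n^2-y_{n+1}^2$. A hypersurface $\phi:M\to N$ of a pseudo-Riemannian manifold $N$ of index $1$ is space-like if its induced metric is positive definite. The tension field is $\tau(\phi)=\mathrm{trace}\,\nabla d\phi$. The second tension field is $\tau_2(\phi)=-\Delta^\phi\tau(\phi)-\mathrm{trace}\,R^N(d\phi,\tau(\phi))d\phi$, where $R^N(X,Y)Z=\nabla_X\nabla_YZ-\nabla_Y\nabla_XZ-\nabla_{[X,Y]}Z$ and $\Delta^\phi=-\mathrm{trace}(\nabla^\phi\nabla^\phi-\nabla^\phi_{\nabla})$ is the (rough) Laplacian on sections of $\phi^{-1}TN$. The hypersurface is biharmonic if its isometric immersion $\phi$ satisfies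 $\tau_2(\phi)=0$, and proper biharmonic if moreover $\phi$ is not harmonic, i.e. $\tau(\phi)\not\equiv0$. *)

(* Defs.v *)
From HB Require Import structures.
From mathcomp Require Import all_boot all_order all_algebra.
From mathcomp Require Import all_classical all_reals all_analysis.

Set Implicit Arguments.
Unset Strict Implicit.
Unset Printing Implicit Defensive.

Import Order.TTheory GRing.Theory Num.Theory.
Import numFieldNormedType.Exports.

Local Open Scope classical_set_scope.
Local Open Scope ring_scope.

Section Smoothness.
Context {R : realType} {V W : normedModType R}.

Fixpoint Ck (k : nat) (U : set V) (f : V -> W) : Prop :=
  if k is k'.+1 then
    (forall x, U x -> differentiable f x) /\
    (forall v, Ck k' U (fun x => 'D_v f x))
  else forall x, U x -> {for x, continuous f}.

(* Intended for U open. *)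
Definition smooth_on (U : set V) (f : V -> W) : Prop := forall k, Ck k U f.

End Smoothness.

(* Pseudo-Riemannian geometry of an open part of R^m carrying a metric g,
   where g x is the Gram matrix of the coordinate frame at x. *)
Section Coordinates.
Context {R : realType}.

Definition frame {m : nat} (i : 'I_m) : 'rV[R]_m := delta_mx 0 i.

(* Gamma^k_ij, the coefficients of the Levi-Civita connection; see
   [christoffel_sym] and [christoffel_metric] below. *)
Definition christoffel {m : nat} (g : 'rV[R]_m -> 'M[R]_m) (i j k : 'I_m)
    (x : 'rV[R]_m) : R :=
  2^-1 * \sum_l invmx (g x) k l *
    ('D_(frame i) (fun z => g z j l) x + 'D_(frame j) (fun z => g z i l) x
     - 'D_(frame l) (fun z => g z i j) x).

(* The connection induced on the sections s of the pull-back of the tangent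
   bundle of (R^p, G) along f : R^m -> R^p, in the direction of the vector
   field X on R^m. *)
Definition pbnabla {m p : nat} (G : 'rV[R]_p -> 'M[R]_p)
    (f : 'rV[R]_m -> 'rV[R]_p) (X : 'rV[R]_m -> 'rV[R]_m)
    (s : 'rV[R]_m -> 'rV[R]_p) (x : 'rV[R]_m) : 'rV[R]_p :=
  'D_(X x) s x +
  \row_k \sum_i \sum_j christoffel G i j k (f x) * ('D_(X x) f x) 0 i * s x 0 j.

Definition nabla {m : nat} (g : 'rV[R]_m -> 'M[R]_m)
    (X Y : 'rV[R]_m -> 'rV[R]_m) : 'rV[R]_m -> 'rV[R]_m :=
  pbnabla g id X Y.

Definition lie_bracket {m : nat} (X Y : 'rV[R]_m -> 'rV[R]_m)
    (x : 'rV[R]_m) : 'rV[R]_m :=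
  'D_(X x) Y x - 'D_(Y x) X x.

Definition riemann {m : nat} (g : 'rV[R]_m -> 'M[R]_m)
    (X Y Z : 'rV[R]_m -> 'rV[R]_m) (x : 'rV[R]_m) : 'rV[R]_m :=
  nabla g X (nabla g Y Z) x - nabla g Y (nabla g X Z) x
  - nabla g (lie_bracket X Y) Z x.

(* The curvature being tensorial, its value on vectors at x is computed on
   their extensions with constant coefficients. *)
Definition curvature {m : nat} (g : 'rV[R]_m -> 'M[R]_m) (x a b c : 'rV[R]_m) :
    'rV[R]_m :=
  riemann g (cst a) (cst b) (cst c) x.

Definition trace {m p : nat} (g : 'rV[R]_m -> 'M[R]_m) (x : 'rV[R]_m)
    (B : 'rV[R]_m -> 'rV[R]_m -> 'rV[R]_p) : 'rV[R]_p :=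
  \sum_i \sum_j invmx (g x) i j *: B (frame i) (frame j).

Section Maps.
Context {m p : nat}.
Variables (g : 'rV[R]_m -> 'M[R]_m) (G : 'rV[R]_p -> 'M[R]_p).
Variable f : 'rV[R]_m -> 'rV[R]_p.

Definition push (X : 'rV[R]_m -> 'rV[R]_m) (x : 'rV[R]_m) : 'rV[R]_p :=
  'D_(X x) f x.

(* (nabla df)(X, Y) = nabla^f_X (df Y) - df (nabla_X Y) *)
Definition nabla_d (X Y : 'rV[R]_m -> 'rV[R]_m) (x : 'rV[R]_m) : 'rV[R]_p :=
  pbnabla G f X (push Y) x - push (nabla g X Y) x.

Definition tension (x : 'rV[R]_m) : 'rV[R]_p :=
  trace g x (fun a b => nabla_d (cst a) (cst b) x).

Definition rough_laplacian (s : 'rV[R]_m -> 'rV[R]_p) (x : 'rV[R]_m) :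
    'rV[R]_p :=
  - trace g x (fun a b => pbnabla G f (cst a) (pbnabla G f (cst b) s) x
                          - pbnabla G f (nabla g (cst a) (cst b)) s x).

Definition bitension (x : 'rV[R]_m) : 'rV[R]_p :=
  - rough_laplacian tension x
  - trace g x (fun a b =>
      curvature G (f x) (push (cst a) x) (tension x) (push (cst b) x)).

End Maps.

Lemma christoffel_sym {m : nat} (g : 'rV[R]_m -> 'M[R]_m) (i j k : 'I_m)
    (x : 'rV[R]_m) :
  (forall z, (g z)^T = g z) -> christoffel g i j k x = christoffel g j i k x.
Proof.
move=> gT; rewrite /christoffel; congr (_ * _); apply: eq_bigr => l _.
rewrite [X in X - _]addrC; congr (_ * (_ - _)); congr ('D_ _ _ x).
by apply/funext => z; rewrite -[g z in LHS]gT mxE.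
Qed.

Lemma christoffel_metric {m : nat} (g : 'rV[R]_m -> 'M[R]_m) (i j k : 'I_m)
    (x : 'rV[R]_m) :
  (forall z, (g z)^T = g z) -> g x \in unitmx ->
  'D_(frame k) (fun z => g z i j) x =
  \sum_l (christoffel g k i l x * g x l j + christoffel g k j l x * g x i l).
Proof.
move=> gT gU.
have lower a b c : \sum_l christoffel g a b l x * g x l c =
    2^-1 * ('D_(frame a) (fun z => g z b c) x + 'D_(frame b) (fun z => g z a c) x
            - 'D_(frame c) (fun z => g z a b) x).
  pose d l := 'D_(frame a) (fun z => g z b l) x
    + 'D_(frame b) (fun z => g z a l) x - 'D_(frame l) (fun z => g z a b) x.
  rewrite -/(d c); transitivity (2^-1 * \sum_l d l * (l == c)%:R); last first.
    rewrite (bigD1 c) //= eqxx mulr1 big1 ?addr0 // => l /negPf ->.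
    by rewrite mulr0.
  transitivity (2^-1 * \sum_l d l * (g x *m invmx (g x)) c l); last first.
    by congr (_ * _); apply: eq_bigr => l _; rewrite mulmxV // mxE eq_sym.
  under [X in _ = _ * X]eq_bigr do rewrite mxE mulr_sumr.
  rewrite exchange_big mulr_sumr; apply: eq_bigr => l _ /=.
  rewrite /christoffel -mulrA; congr (_ * _); rewrite mulr_suml.
  apply: eq_bigr => l' _; rewrite -/(d l').
  have -> : g x l c = g x c l by rewrite -[g x in LHS]gT mxE.
  by rewrite [invmx _ _ _ * d _]mulrC -mulrA [invmx _ _ _ * _]mulrC.
have gE a b : (fun z => g z a b) = (fun z => g z b a).
  by apply/funext => z; rewrite -[g z in LHS]gT mxE.
rewrite big_split /= lower.
under [X in _ = _ + X]eq_bigr => l _.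
  have -> : g x i l = g x l i by rewrite -[g x in LHS]gT mxE.
over.
rewrite lower (gE j i) -mulrDr.
set A := 'D_ _ _ _; set B := 'D_ _ _ _; set C := 'D_ _ _ _.
have -> : A + B - C + (A + C - B) = 2 * A.
  by rewrite addrACA -opprD addrACA [C + B]addrC addrK mulr_natl mulr2n.
by rewrite mulrA mulVf ?mul1r // pnatr_eq0.
Qed.

End Coordinates.

Section Submanifolds.
Context {R : realType}.

(* A subset of R^N, meant as an m-dimensional submanifold, together with the
   bilinear form on R^N that induces its metric. *)
Record subm (m N : nat) := Subm {
  carrier :> set 'rV[R]_N ;
  form : 'rV[R]_N -> 'rV[R]_N -> R }.

(* A diffeomorphism between an open subset of R^m and a relatively open subset
   of S, whose inverse is the restriction of a smooth map defined on an open
   subset of the ambient space. *)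
Record chart (m N : nat) (S : set 'rV[R]_N) := Chart {
  dom : set 'rV[R]_m ;
  par : 'rV[R]_m -> 'rV[R]_N ;
  nbh : set 'rV[R]_N ;
  coo : 'rV[R]_N -> 'rV[R]_m ;
  dom_open : open dom ;
  nbh_open : open nbh ;
  par_smooth : smooth_on dom par ;
  coo_smooth : smooth_on nbh coo ;
  par_in : forall u, dom u -> (S `&` nbh) (par u) ;
  coo_in : forall y, (S `&` nbh) y -> dom (coo y) ;
  parK : forall u, dom u -> coo (par u) = u ;
  cooK : forall y, (S `&` nbh) y -> par (coo y) = y }.

Definition submanifold (m N : nat) (S : set 'rV[R]_N) : Prop :=
  forall y, S y -> exists c : chart m S, nbh c y.

(* Pull-back of the bilinear form b by X, in the coordinate frame. *)
Definition pullback_metric {m N : nat} (b : 'rV[R]_N -> 'rV[R]_N -> R)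
    (X : 'rV[R]_m -> 'rV[R]_N) (u : 'rV[R]_m) : 'M[R]_m :=
  \matrix_(i, j) b ('D_(frame i) X u) ('D_(frame j) X u).

Definition metric {m N : nat} (M : subm m N) (c : chart m M) :
    'rV[R]_m -> 'M[R]_m :=
  pullback_metric (form M) (par c).

Definition qform {m : nat} (A : 'M[R]_m) (v : 'rV[R]_m) : R :=
  (v *m A *m v^T) 0 0.

Definition positive_definite {m : nat} (A : 'M[R]_m) : Prop :=
  forall v, v != 0 -> 0 < qform A v.

Definition negative_on {m k : nat} (A : 'M[R]_m) (W : 'M[R]_(k, m)) : Prop :=
  forall v, (v <= W)%MS -> v != 0 -> qform A v < 0.

(* The index is the largest dimension of a subspace (here a row space) on
   which the form is negative definite. *)
Definition has_index {m : nat} (A : 'M[R]_m) (nu : nat) : Prop :=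
  (exists W : 'M[R]_m, negative_on A W /\ \rank W = nu) /\
  (forall W : 'M[R]_m, negative_on A W -> (\rank W <= nu)%N).

Definition pseudo_riemannian {m N : nat} (M : subm m N) (nu : nat) : Prop :=
  submanifold m M /\
  forall (c : chart m M) u, dom c u ->
    [/\ (metric c u)^T = metric c u, metric c u \in unitmx
      & has_index (metric c u) nu].

(* In what follows a map between submanifolds is given by a map between the
   ambient spaces, of which only the restriction to M is used. *)
Section Hypersurfaces.
Context {m p K L : nat}.
Variables (M : subm m K) (N : subm p L) (phi : 'rV[R]_K -> 'rV[R]_L).

Definition smooth_map : Prop :=
  (forall y, carrier M y -> carrier N (phi y)) /\
  (forall c : chart m M, smooth_on (dom c) (phi \o par c)).

Definition isometric : Prop :=
  forall (c : chart m M) u, dom c u ->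
    pullback_metric (form N) (phi \o par c) u = metric c u.

Definition immersion : Prop :=
  smooth_map /\
  forall (c : chart m M) u, dom c u ->
    forall v, v != 0 -> 'D_v (phi \o par c) u != 0.

(* The last clause says that phi is a homeomorphism from M onto its image. *)
Definition embedding : Prop :=
  [/\ immersion, {in carrier M &, injective phi}
    & forall A, open A ->
        exists2 B, open B & M `&` A = M `&` phi @^-1` B].

Definition spacelike_hypersurface : Prop :=
  [/\ p = m.+1, submanifold m M, pseudo_riemannian N 1, immersion
    & forall (c : chart m M) u, dom c u ->
        positive_definite (pullback_metric (form N) (phi \o par c) u)].

Definition coord_map (c : chart m M) (d : chart p N) :
    'rV[R]_m -> 'rV[R]_p :=
  coo d \o phi \o par c.

Definition harmonic : Prop :=
  forall (c : chart m M) (d : chart p N) u,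
    dom c u -> nbh d (phi (par c u)) ->
    tension (metric c) (metric d) (coord_map c d) u = 0.

Definition biharmonic : Prop :=
  forall (c : chart m M) (d : chart p N) u,
    dom c u -> nbh d (phi (par c u)) ->
    bitension (metric c) (metric d) (coord_map c d) u = 0.

Definition proper_biharmonic : Prop := biharmonic /\ ~ harmonic.

End Hypersurfaces.

(* The scalar product of R^N with n plus signs followed by N - n minus signs. *)
Definition sprod (n : nat) {N : nat} (x y : 'rV[R]_N) : R :=
  \sum_(i < N) (if (i < n)%N then x 0 i * y 0 i else - (x 0 i * y 0 i)).

Definition anti_de_sitter (n : nat) : subm n.+1 (n + 1 + 1) :=
  Subm n.+1 [set x | sprod n x x = -1] (sprod n).

Definition hyperbolic_space (n : nat) (r : R) : subm n (n + 1) :=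
  Subm n (connected_component [set y | sprod n y y = - r ^+ 2]
                              (row_mx 0 (const_mx r)))
         (sprod n).

End Submanifolds.

(* Main.v *)
Require Import Defs.
From HB Require Import structures.
From mathcomp Require Import all_boot all_order all_algebra.
From mathcomp Require Import all_classical all_reals all_analysis.
From mathcomp Require Import ring lra.

(** All the geometry is read off in the flat ambient space. Let Y parametrize an
    open part of the quadric <y, y> = - kappa; then Y itself is a normal
    vector field. The differential of Y is injective, so an equality of
    tangent vectors may be checked after applying it. The Levi-Civita
    connection then becomes the ambient derivative followed by the orthogonal
    projection along Y: this is [gauss_formula] for the Christoffel symbols,
    and [pbnabla_lift] for sections of a pull-back bundle. Applied twice, it
    yields the constant curvature - 1 / kappa ([curvature_lift]).

    Now let X parametrize the sheet H of <y, y> = - r ^ 2, and let F = (X, r),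
    with r ^ 2 = 1 / 2. The field xi = (X, - r) along F is tangent to the anti
    de Sitter space and normal to the image of F, and it has the same
    derivative as F. So the second fundamental form is g * xi
    ([second_form]) and the tension is tau = m xi ([tension_lift]), where m is
    the dimension of H. Moreover nabla_v xi = dF v, so that
    nabla_v tau = m dF v ([nabla_tension]). A second derivative brings back the
    second fundamental form, and the trace of the Hessian of tau is m tau. As
    tau is normal and the target has curvature - 1, the curvature term of the
    bitension is m tau as well, and the two cancel ([bitension_eq0]); while
    tau itself vanishes nowhere. The equation
    r ^ 2 = 1 / 2 puts F in the anti de Sitter space, and it makes the normal
    part (X / r ^ 2, 0) - (X, r) of the second derivative equal to xi, because
    1 / r ^ 2 - 1 = 1.

    The remaining facts are of a different nature. Graphs over coordinate
    hyperplanes give enough charts on the quadrics ([graph_chart]), the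
    connected component H is the whole upper sheet ([sheet_pos],
    [sheet_upper]), and the index of the induced metrics is found by comparing
    dimensions ([index_le]). *)

Set Implicit Arguments.
Unset Strict Implicit.
Unset Printing Implicit Defensive.

Import Order.TTheory GRing.Theory Num.Theory.
Import numFieldNormedType.Exports.

Local Open Scope classical_set_scope.
Local Open Scope ring_scope.

(** * Directional derivatives of vector-valued maps *)

Section Derivatives.
Context {R : realType}.

Lemma derive_comp {U V W : normedModType R} (g : U -> V) (f : V -> W) x v :
  differentiable g x -> differentiable f (g x) ->
  'D_v (fun y => f (g y)) x = 'D_('D_v g x) f (g x).
Proof.
move=> dg df; rewrite !deriveE //; last exact: (differentiable_comp dg df).
by rewrite [LHS](congr1 (fun h : U -> W => h v) (diff_comp dg df)).
Qed.

Lemma deriveDv {V W : normedModType R} (f : V -> W) x u v :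
  differentiable f x -> 'D_(u + v) f x = 'D_u f x + 'D_v f x.
Proof. by move=> df; rewrite !deriveE // linearD. Qed.

Lemma deriveZv {V W : normedModType R} (f : V -> W) x a v :
  differentiable f x -> 'D_(a *: v) f x = a *: 'D_v f x.
Proof. by move=> df; rewrite !deriveE // linearZ. Qed.

Lemma deriveBv {V W : normedModType R} (f : V -> W) x u v :
  differentiable f x -> 'D_(u - v) f x = 'D_u f x - 'D_v f x.
Proof. by move=> df; rewrite !deriveE // linearB. Qed.

Lemma derive_frames {m} {W : normedModType R} (f : 'rV[R]_m -> W) x v :
  differentiable f x -> 'D_v f x = \sum_i v 0 i *: 'D_(frame i) f x.
Proof.
move=> df; rewrite deriveE // {1}[v]row_sum_delta linear_sum /=.
by apply: eq_bigr => i _; rewrite linearZ /= deriveE.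
Qed.

Lemma differentiable_entry {V : normedModType R} {n} (f : V -> 'rV[R]_n) x j :
  differentiable f x -> differentiable (fun y => f y 0 j) x.
Proof.
move=> df; apply: (@differentiable_comp _ _ _ _ f (fun M : 'rV[R]_n => M 0 j)) => //.
exact: differentiable_coord.
Qed.

Lemma differentiable_row {V : normedModType R} {n} (f : V -> 'rV[R]_n) x :
  (forall j, differentiable (fun y => f y 0 j) x) -> differentiable f x.
Proof.
move=> df; rewrite (_ : f = \sum_(j < n) (fun y => f y 0 j *: delta_mx 0 j)).
  by apply: differentiable_sum => j; exact: differentiableZl.
by apply/funext => y; rewrite fct_sumE {1}[f y]row_sum_delta.
Qed.

Lemma derive_entry {V : normedModType R} {n} (f : V -> 'rV[R]_n) x v j :
  differentiable f x -> ('D_v f x) 0 j = 'D_v (fun y => f y 0 j) x.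
Proof. by move=> df; rewrite derive_mx ?mxE //; exact: diff_derivable. Qed.

Lemma derive_sumE {V W : normedModType R} {n} (h : 'I_n -> V -> W) x v :
  (forall i, derivable (h i) x v) ->
  'D_v (fun y => \sum_(i < n) h i y) x = \sum_(i < n) 'D_v (h i) x.
Proof.
move=> dh; rewrite -derive_sum //; congr ('D_v _ x).
by apply/funext => y; rewrite fct_sumE.
Qed.

Lemma differentiable_sumE {V W : normedModType R} {n} (h : 'I_n -> V -> W) x :
  (forall i, differentiable (h i) x) ->
  differentiable (fun y => \sum_(i < n) h i y) x.
Proof.
move=> dh; rewrite (_ : (fun _ => _) = \sum_(i < n) h i); first exact: differentiable_sum.
by apply/funext => y; rewrite fct_sumE.
Qed.

Lemma differentiable_scale {V : normedModType R} {n} (k : V -> R)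
    (f : V -> 'rV[R]_n) x :
  differentiable k x -> differentiable f x ->
  differentiable (fun y => k y *: f y) x.
Proof.
move=> dk df; apply: differentiable_row => j.
under eq_fun do rewrite mxE.
by apply: differentiableM => //; exact: differentiable_entry.
Qed.

Lemma derive_scale {V : normedModType R} {n} (k : V -> R)
    (f : V -> 'rV[R]_n) x v :
  differentiable k x -> differentiable f x ->
  'D_v (fun y => k y *: f y) x = 'D_v k x *: f x + k x *: 'D_v f x.
Proof.
move=> dk df; apply/rowP => j.
rewrite derive_entry; last exact: differentiable_scale.
under [X in 'D_v X x]eq_fun do rewrite mxE.
have dfj := differentiable_entry j df.
rewrite [LHS]deriveM; [|exact: diff_derivable..].
by rewrite !mxE derive_entry // addrC [f x 0 j *: _]mulrC.
Qed.

Lemma derive_mull {V : normedModType R} (h : V -> R) x v a :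
  differentiable h x -> 'D_v (fun y => a * h y) x = a * 'D_v h x.
Proof. by move=> dh; rewrite [LHS](deriveZ a (diff_derivable dh)). Qed.

Lemma derive_eq_on {V W : normedModType R} (U : set V) (f g : V -> W) x v :
  open U -> U x -> (forall y, U y -> f y = g y) -> 'D_v f x = 'D_v g x.
Proof.
move=> oU Ux fg; apply: near_eq_derive.
by apply: filterS (open_nbhs_nbhs (conj oU Ux)).
Qed.

(** The difference g - f vanishes near x, so its differential at x is 0. *)
Lemma differentiable_eq_on {V W : normedModType R} (U : set V) (f g : V -> W) x :
  open U -> U x -> (forall y, U y -> f y = g y) ->
  differentiable f x -> differentiable g x.
Proof.
move=> oU Ux fg df.
pose e : V -> W := g - f.
have e0 : e \o shift x = cst (e x) + (\0 : {linear V -> W}) +o_ 0 id.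
  apply/eqaddoP => _/posnumP[eps]; near=> h.
  rewrite -![(_ + _ : _ -> _) _]/(_ + _) -![(- _ : _ -> _) _]/(- _) /=.
  have Uh : U (h + x).
    near: h; have := open_nbhs_nbhs (conj oU Ux).
    rewrite -[nbhs x U]/(\forall y \near x, U y) nbhs0P; apply: filterS => h.
    by rewrite addrC.
  rewrite /cst /e -![(_ + _ : _ -> _) _]/(_ + _) -![(- _ : _ -> _) _]/(- _).
  rewrite -!fg // !subrr addr0 subr0 normr0 mulr_ge0 //.
have de : differentiable e x.
  apply/diff_locallyP; have c0 : continuous (\0 : V -> W) by exact: cst_continuous.
  by rewrite (diff_unique c0 e0).
rewrite (_ : g = f + e); first exact: differentiableD.
by rewrite /e addrC subrK.
Unshelve. all: by end_near. Qed.

End Derivatives.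

(** * Calculus of C^k maps *)

Section Smooth.
Context {R : realType} {V : normedModType R}.
Implicit Types (U : set V) (k : nat).

Lemma CkW {W : normedModType R} k U (f : V -> W) : Ck k.+1 U f -> Ck k U f.
Proof.
elim: k f => [|k IH] f [df Df]; last by split => // v; exact/IH/Df.
by move=> x Ux; exact/differentiable_continuous/df.
Qed.

Lemma eq_on_Ck {W : normedModType R} k U (f g : V -> W) :
  open U -> (forall x, U x -> f x = g x) -> Ck k U f -> Ck k U g.
Proof.
move=> oU; elim: k f g => [|k IH] f g fg.
  move=> cf x Ux; have /= := cf x Ux; rewrite /prop_for /continuous_at -fg //.
  apply: cvg_trans; apply: near_eq_cvg.
  by apply: filterS (open_nbhs_nbhs (conj oU Ux)).
case=> df Df; split=> [x Ux|v]; first by apply: (differentiable_eq_on oU Ux fg); exact: df.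
by apply: IH (Df v) => x Ux; exact: derive_eq_on oU Ux fg.
Qed.

Lemma smooth_differentiable {W : normedModType R} U (f : V -> W) x :
  smooth_on U f -> U x -> differentiable f x.
Proof. by move=> /(_ 1)[+ _]; apply. Qed.

Lemma smooth_derive {W : normedModType R} U (f : V -> W) v :
  smooth_on U f -> smooth_on U ('D_v f).
Proof. by move=> sf k; have [_] := sf k.+1; apply. Qed.

Lemma Ck_cst {W : normedModType R} k U (c : W) : Ck k U (fun=> c).
Proof.
elim: k c => [|k IH] c; first by move=> x _; exact: cst_continuous.
split=> [x _|v]; first exact: differentiable_cst.
rewrite (_ : 'D_v _ = fun=> 0) //; apply/funext => x; exact: derive_cst.
Qed.

Lemma CkD {W : normedModType R} k U (f g : V -> W) :
  open U -> Ck k U f -> Ck k U g -> Ck k U (fun x => f x + g x).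
Proof.
move=> oU; elim: k f g => [|k IH] f g.
  by move=> cf cg x Ux; apply: continuousD; [exact: cf|exact: cg].
move=> [df Df] [dg Dg]; split=> [x Ux|v].
  by apply: differentiableD; [exact: df|exact: dg].
apply: eq_on_Ck (IH _ _ (Df v) (Dg v)) => // x Ux.
by rewrite -deriveD //; apply: diff_derivable; [exact: df|exact: dg].
Qed.

Lemma CkM k U (f g : V -> R) :
  open U -> Ck k U f -> Ck k U g -> Ck k U (fun x => f x * g x).
Proof.
move=> oU; elim: k f g => [|k IH] f g.
  by move=> cf cg x Ux; apply: continuousM; [exact: cf|exact: cg].
move=> Cf Cg; move: (Cf) (Cg) => [df Df] [dg Dg]; split=> [x Ux|v].
  by apply: differentiableM; [exact: df|exact: dg].
apply: eq_on_Ck (CkD oU (IH _ _ (CkW Cf) (Dg v)) (IH _ _ (CkW Cg) (Df v))) => // x Ux.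
by rewrite [RHS]deriveM //; apply: diff_derivable; [exact: df|exact: dg].
Qed.

Lemma Ck_sum {n} k U (h : 'I_n -> V -> R) :
  open U -> (forall i, Ck k U (h i)) -> Ck k U (fun x => \sum_i h i x).
Proof.
move=> oU Ch; rewrite -fct_sumE; elim/big_ind : _ => //; first exact: Ck_cst.
by move=> f g; exact: CkD.
Qed.

Lemma CkV k U (f : V -> R) : open U -> (forall x, U x -> f x != 0) ->
  Ck k U f -> Ck k U (fun x => (f x)^-1).
Proof.
move=> oU f0; elim: k => [|k IH].
  by move=> cf x Ux; apply: continuousV; [exact: f0|exact: cf].
move=> Cf; move: (Cf) => [df Df]; split=> [x Ux|v].
  by apply: differentiableV; [exact: df|exact: f0].
have CV := IH (CkW Cf).
apply: eq_on_Ck (CkM oU (CkM oU (Ck_cst k U (-1 : R)) (CkM oU CV CV)) (Df v)) => // x Ux.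
rewrite deriveV ?f0 //; last by apply: diff_derivable; exact: df.
by rewrite -[_ *: _]/(_ * _) mulN1r expr2 invfM.
Qed.

Lemma differentiable_sqrt (t : R) : 0 < t -> differentiable Num.sqrt t.
Proof.
by move=> t0; apply/derivable1_diffP; have [] := is_derive1_sqrt t0.
Qed.

(** The derivative of sqrt f is f' * sqrt f / (2 * f), a product of sqrt f
    with functions that are of class C^k as soon as f is of class C^k+1; hence
    the induction. *)
Lemma Ck_sqrt k U (f : V -> R) : open U -> (forall x, U x -> 0 < f x) ->
  Ck k U f -> Ck k U (fun x => Num.sqrt (f x)).
Proof.
move=> oU f0; elim: k => [|k IH].
  move=> cf x Ux; apply: (continuous_comp (cf x Ux)).
  exact: sqrt_continuous.
move=> Cf; move: (Cf) => [df Df]; split=> [x Ux|v].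
  by apply: (differentiable_comp (df x Ux)); exact/differentiable_sqrt/f0.
have CV : Ck k U (fun x => (2 * f x)^-1).
  apply: CkV => // [x /f0 fx|]; first by rewrite mulf_neq0 ?gt_eqF.
  by apply: CkM => //; [exact: Ck_cst|exact: CkW].
apply: eq_on_Ck (CkM oU (CkM oU (Df v) (IH (CkW Cf))) CV) => // x Ux.
have fx := f0 x Ux.
rewrite (derive_comp (f := Num.sqrt)); [|exact: df|exact: differentiable_sqrt].
rewrite -[X in 'D_X _ (f x)]mulr1 deriveZv; last exact: differentiable_sqrt.
rewrite derive_sqrt // -[RHS]/(_ * _) -mulrA; congr (_ * _).
have s0 : Num.sqrt (f x) != 0 by rewrite gt_eqF // sqrtr_gt0.
rewrite -{2}[f x]sqr_sqrtr ?ltW // expr2 mulrA invfM mulrC -mulrA mulVf //.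
by rewrite mulr1.
Qed.

Lemma Ck_row {n} k U (f : V -> 'rV[R]_n) : open U ->
  (forall j, Ck k U (fun x => f x 0 j)) -> Ck k U f.
Proof.
move=> oU; elim: k f => [|k IH] f Cf.
  move=> x Ux; apply/cvgrPdist_le => /= e e0; near=> y.
  rewrite /Num.Def.normr/= mx_normrE (bigmax_le _ (ltW e0))//= => -[i j] _.
  rewrite !mxE /= ord1; move: j; near: y; apply: filter_forall => /= j.
  exact: (cvgrPdist_le _ _).1 (Cf j x Ux) e e0.
have df x : U x -> differentiable f x.
  by move=> Ux; apply: differentiable_row => j; have [+ _] := Cf j; apply.
split=> // v; apply: IH => j; have [_ /(_ v)] := Cf j.
by apply: eq_on_Ck => // x Ux; rewrite derive_entry //; exact: df.
Unshelve. all: by end_near. Qed.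

Lemma Ck_entry {n} k U (f : V -> 'rV[R]_n) j : open U ->
  Ck k U f -> Ck k U (fun x => f x 0 j).
Proof.
move=> oU; elim: k f => [|k IH] f.
  move=> cf x Ux; 
  apply: (@continuous_comp _ _ _ f (fun M : 'rV[R]_n => M 0 j)); first exact: cf.
  exact: coord_continuous.
move=> [df Df]; split=> [x Ux|v]; first by apply: differentiable_entry; exact: df.
apply: eq_on_Ck (IH _ (Df v)) => // x Ux.
by rewrite derive_entry //; exact: df.
Qed.

End Smooth.

Lemma Ck_coord {R : realType} {n} k U j : Ck k U (fun x : 'rV[R]_n => x 0 j).
Proof.
case: k => [|k]; first by move=> x _; exact: coord_continuous.
split=> [x _|v]; first exact: differentiable_coord.
rewrite (_ : 'D_v _ = fun=> v 0 j); first exact: Ck_cst.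
apply/funext => x; rewrite -(derive_entry (f := id)) //.
by rewrite derive_id.
Qed.

(** * Symmetry of second derivatives *)

(* Unification would otherwise unfold distinct directional derivatives into
   limits in order to compare them. *)
Local Opaque derive.

Section Schwarz.
Context {R : realType} {V : normedModType R}.
Implicit Types (f : V -> R) (U : set V).

Lemma is_derive_line f (a u : V) (t : R) : differentiable f (a + t *: u) ->
  is_derive t 1 (fun s : R => f (a + s *: u)) ('D_u f (a + t *: u)).
Proof.
move=> df; have dl : differentiable (fun s : R => a + s *: u) t by [].
apply: DeriveDef; first exact/diff_derivable/(differentiable_comp dl).
have -> : 'D_1 (fun s : R => f (a + s *: u)) t =
    'D_('D_1 (fun s : R => a + s *: u) t) f (a + t *: u) := derive_comp (1 : R) dl df.
congr ('D__ f _); have dZ : differentiable (fun s : R => s *: u) t by [].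
rewrite (deriveD (f := fun=> a) (g := fun s : R => s *: u)) //; last exact: diff_derivable.
by rewrite derive_cst add0r deriveE // diff_val scale1r.
Qed.

Lemma mvt_line f (a u : V) (h : R) : 0 < h ->
  (forall t, 0 <= t <= h -> differentiable f (a + t *: u)) ->
  exists2 t, 0 <= t <= h & f (a + h *: u) - f a = h * 'D_u f (a + t *: u).
Proof.
move=> h0 df; pose g (s : R) := f (a + s *: u).
have gd t : 0 <= t <= h -> is_derive t 1 g ('D_u f (a + t *: u)).
  by move=> th; exact/is_derive_line/df.
have [||t th gE] := @MVT R g (fun t => 'D_u f (a + t *: u)) 0 h h0.
- by move=> t /itvP th; apply: gd; rewrite !th.
- apply: derivable_within_continuous => t /itvP th.
  by have [] : is_derive t 1 g ('D_u f (a + t *: u)) by apply: gd; rewrite !th.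
- exists t; first by move: th => /itvP th; rewrite !th.
  by move: gE; rewrite /g scale0r addr0 subr0 mulrC.
Qed.

(** Two applications of the mean value theorem, to x |-> f (x + h v) - f x along
    u and then to the derivative along u, turn the second difference into
    h ^ 2 times a value of the second derivative at a nearby point. *)
Lemma second_difference f (a u v : V) (h : R) : 0 < h ->
  (forall s t, 0 <= s <= h -> 0 <= t <= h ->
     differentiable f (a + s *: u + t *: v) /\
     differentiable ('D_u f) (a + s *: u + t *: v)) ->
  exists st : R * R, [/\ 0 <= st.1 <= h, 0 <= st.2 <= h &
    f (a + h *: u + h *: v) - f (a + h *: u) - (f (a + h *: v) - f a)
      = h * (h * 'D_v ('D_u f) (a + st.1 *: u + st.2 *: v))].
Proof.
move=> h0 df; have hh : 0 <= h <= h by rewrite (ltW h0) lexx.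
have h00 : (0 : R) <= 0 <= h by rewrite (ltW h0) lexx.
pose g x := f (x + h *: v) - f x.
have d1 s : 0 <= s <= h -> differentiable (fun x => f (x + h *: v)) (a + s *: u).
  move=> sh; apply: (@differentiable_comp _ _ _ _ (fun x => x + h *: v) f) => //.
  by have [] := df s h sh hh.
have d2 s : 0 <= s <= h -> differentiable f (a + s *: u).
  by move=> sh; have [] := df s 0 sh h00; rewrite scale0r addr0.
have [s sh gE] : exists2 s, 0 <= s <= h &
    g (a + h *: u) - g a = h * 'D_u g (a + s *: u).
  by apply: mvt_line => // s sh; apply: differentiableB; [exact: d1|exact: d2].
have [t th DE] : exists2 t, 0 <= t <= h &
   'D_u f (a + s *: u + h *: v) - 'D_u f (a + s *: u)
     = h * 'D_v ('D_u f) (a + s *: u + t *: v).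
  by apply: (@mvt_line ('D_u f) (a + s *: u) v h h0) => t th; have [] := df s t sh th.
exists (s, t); split => //=; rewrite -DE -[LHS]/(g (a + h *: u) - g a) gE.
congr (_ * _); rewrite deriveB; [|apply: diff_derivable..]; rewrite /=; last first.
- exact: d2.
- exact: d1.
congr (_ - _); rewrite (derive_comp (g := fun x => x + h *: v)) //; last first.
  by have [] := df s h sh hh.
by rewrite deriveD // derive_cst derive_id addr0.
Qed.

(** The second difference is symmetric in u and v; being h ^ 2 times a value of
    either mixed derivative, it forces both to have the same limit at x. *)
Lemma schwarz_real U f x u v : open U -> U x -> smooth_on U f ->
  'D_u ('D_v f) x = 'D_v ('D_u f) x.
Proof.
move=> oU Ux sf; apply/eqP; rewrite -subr_eq0 -normr_le0; apply/ler_addgt0Pr => e e0.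
rewrite add0r.
have cD w w' : {for x, continuous ('D_w ('D_w' f))}.
  apply/differentiable_continuous/(@smooth_differentiable _ _ _ U) => //.
  by do 2 apply: smooth_derive.
have e2 : 0 < e / 2 by rewrite divr_gt0.
have nU : nbhs x (fun y => [/\ U y,
    `|'D_u ('D_v f) x - 'D_u ('D_v f) y| < e / 2
    & `|'D_v ('D_u f) x - 'D_v ('D_u f) y| < e / 2]).
  have nUV : \forall y \near x, `|'D_u ('D_v f) x - 'D_u ('D_v f) y| < e / 2.
    exact: (cvgrPdist_lt _ _).1 (cD u v) _ e2.
  have nVU : \forall y \near x, `|'D_v ('D_u f) x - 'D_v ('D_u f) y| < e / 2.
    exact: (cvgrPdist_lt _ _).1 (cD v u) _ e2.
  apply: filterS (filterI (open_nbhs_nbhs (conj oU Ux)) (filterI nUV nVU)).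
  by move=> y [Uy [? ?]]; split.
have /nbhs_ballP[r /= r0 rU] := nU.
(* The parallelogram with sides h u and h v lies in the ball of radius r; the
   summand 1 keeps the denominator positive. *)
pose h := r / 2 / (`|u| + `|v| + 1).
have n0 : 0 < `|u| + `|v| + 1 by rewrite ltr_wpDl // addr_ge0.
have h0 : 0 < h by rewrite divr_gt0 // divr_gt0.
have near_x s t : 0 <= s <= h -> 0 <= t <= h -> ball x r (x + s *: u + t *: v).
  move=> /andP[s0 sh] /andP[t0 th].
  rewrite -ball_normE /= opprD addrA opprD addrA subrr sub0r -opprD normrN.
  apply: (le_lt_trans (ler_normD _ _)); rewrite !normrZ !ger0_norm //.
  apply: (@le_lt_trans _ _ (h * (`|u| + `|v| + 1))).
    rewrite !mulrDr mulr1 -addrA lerD ?ler_wpM2r //.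
    by apply: ler_wpDr; [exact: ltW|exact: ler_wpM2r].
  by rewrite divfK ?gt_eqF // ltr_pdivrMr // mulr2n mulrDr mulr1 ltrDl.
have dfs w w' s t : 0 <= s <= h -> 0 <= t <= h ->
    ball x r (x + s *: w + t *: w') ->
    differentiable f (x + s *: w + t *: w') /\
    differentiable ('D_w f) (x + s *: w + t *: w').
  move=> sh th /rU[Uy _ _]; split; apply: smooth_differentiable Uy => //.
  exact: smooth_derive.
have [|[s t] /= [sh th E1]] := @second_difference f x u v h h0.
  by move=> s t sh th; apply: dfs => //; exact: near_x.
have [|[s' t'] /= [sh' th' E2]] := @second_difference f x v u h h0.
  by move=> s' t' sh' th'; apply: dfs => //; rewrite addrAC; exact: near_x.
have E : 'D_v ('D_u f) (x + s *: u + t *: v) = 'D_u ('D_v f) (x + s' *: v + t' *: u).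
  apply: (mulfI (lt0r_neq0 h0)); apply: (mulfI (lt0r_neq0 h0)).
  apply: etrans (esym E1) (etrans _ E2).
  by rewrite (addrAC x (h *: v)) !opprB addrACA [RHS]addrACA [in RHS](addrC (- f _)).
have [_ _ A1] := rU _ (near_x _ _ sh th).
have [_ A2 _] : [/\ U (x + s' *: v + t' *: u), 
    `|'D_u ('D_v f) x - 'D_u ('D_v f) (x + s' *: v + t' *: u)| < e / 2
    & `|'D_v ('D_u f) x - 'D_v ('D_u f) (x + s' *: v + t' *: u)| < e / 2].
  by apply: rU; rewrite addrAC; exact: near_x.
rewrite -(subrKA ('D_u ('D_v f) (x + s' *: v + t' *: u))) (splitr e).
apply: (le_trans (ler_normD _ _)); apply: lerD; first exact: ltW.
rewrite distrC; apply: ltW.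
exact: eq_ind _ (fun z => `|'D_v ('D_u f) x - z| < e / 2) A1 _ E.
Qed.

Lemma schwarz {n} U (f : V -> 'rV[R]_n) x u v : open U -> U x -> smooth_on U f ->
  'D_u ('D_v f) x = 'D_v ('D_u f) x.
Proof.
move=> oU Ux sf; apply/rowP => j.
have df w y : U y -> ('D_w f y) 0 j = 'D_w (fun y => f y 0 j) y.
  by move=> Uy; rewrite derive_entry //; exact: smooth_differentiable Uy.
have dD w : differentiable ('D_w f) x.
  by apply: smooth_differentiable Ux; exact: smooth_derive.
apply: etrans (derive_entry u j (dD v)) _.
apply: etrans (derive_eq_on u oU Ux (df v)) _.
apply: etrans _ (esym (derive_entry v j (dD u))).
apply: etrans _ (esym (derive_eq_on v oU Ux (df u))).
by apply: (schwarz_real u v oU Ux) => k; exact: Ck_entry oU (sf k).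
Qed.

End Schwarz.

(** * The scalar product *)

Section ScalarProduct.
Context {R : realType} (n N : nat).
Implicit Types x y z : 'rV[R]_N.

Definition sgnat (i : nat) : R := if (i < n)%N then 1 else -1.

Lemma sgnat_sqr i : sgnat i * sgnat i = 1.
Proof. by rewrite /sgnat; case: ifP; rewrite ?mulrNN mulr1. Qed.

Lemma sprodE x y : sprod n x y = \sum_(i < N) sgnat i * (x 0 i * y 0 i).
Proof.
by apply: eq_bigr => i _; rewrite /sgnat; case: ifP; rewrite ?mul1r ?mulN1r.
Qed.

Lemma sprodC x y : sprod n x y = sprod n y x.
Proof. by rewrite !sprodE; apply: eq_bigr => i _; rewrite [x 0 i * _]mulrC. Qed.

Lemma sprod_is_linear x : linear_for *%R (sprod n x).
Proof.
move=> a y z; rewrite !sprodE mulr_sumr -big_split; apply: eq_bigr => i _ /=.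
by rewrite !mxE; ring.
Qed.

HB.instance Definition _ x :=
  GRing.isLinear.Build R 'rV[R]_N R _ (sprod n x) (sprod_is_linear x).

Lemma sprodDl x y z : sprod n (x + y) z = sprod n x z + sprod n y z.
Proof. by rewrite !(sprodC _ z) linearD. Qed.

Lemma sprodBl x y z : sprod n (x - y) z = sprod n x z - sprod n y z.
Proof. by rewrite !(sprodC _ z) linearB. Qed.

Lemma sprodZl a x y : sprod n (a *: x) y = a * sprod n x y.
Proof. by rewrite !(sprodC _ y) linearZ. Qed.

Lemma sprodDr x y z : sprod n x (y + z) = sprod n x y + sprod n x z.
Proof. exact: linearD. Qed.

Lemma sprodBr x y z : sprod n x (y - z) = sprod n x y - sprod n x z.
Proof. exact: linearB. Qed.

Lemma sprodZr a x y : sprod n x (a *: y) = a * sprod n x y.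
Proof. exact: linearZ. Qed.

Lemma sprod_delta x i : sprod n x (delta_mx 0 i) = sgnat i * x 0 i.
Proof.
rewrite sprodE (bigD1 i) //= big1 ?addr0; first by rewrite mxE !eqxx mulr1.
by move=> j ji; rewrite mxE (negPf ji) andbF mulr0 mulr0.
Qed.

Lemma sprod_nondegenerate x : (forall y, sprod n x y = 0) -> x = 0.
Proof.
move=> x0; apply/rowP => i; rewrite mxE; have := x0 (delta_mx 0 i).
rewrite sprod_delta => /(congr1 ( *%R (sgnat i))).
by rewrite mulrA sgnat_sqr mul1r mulr0.
Qed.

Lemma sprod_mul x y : sprod n x y = (x *m (\row_i (sgnat i * y 0 i))^T) 0 0.
Proof. by rewrite sprodE mxE; apply: eq_bigr => i _; rewrite !mxE mulrCA. Qed.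

Section Derivatives.
Context {V : normedModType R}.
Implicit Types (X Y : V -> 'rV[R]_N) (p : V).

Lemma differentiable_sprod X Y p : differentiable X p -> differentiable Y p ->
  differentiable (fun q : V => sprod n (X q) (Y q)) p.
Proof.
move=> dX dY; under eq_fun do rewrite sprodE.
apply: differentiable_sumE => i; apply: differentiableM => //.
by apply: differentiableM; exact: differentiable_entry.
Qed.

Lemma derive_sprod X Y p v : differentiable X p -> differentiable Y p ->
  'D_v (fun q : V => sprod n (X q) (Y q)) p
    = sprod n ('D_v X p) (Y p) + sprod n (X p) ('D_v Y p).
Proof.
move=> dX dY; have dXi i := differentiable_entry i dX.
have dYi i := differentiable_entry i dY.
under [X in 'D_v X p]eq_fun do rewrite sprodE.
rewrite derive_sumE => [|i]; last first.
  by apply: diff_derivable; apply: differentiableM => //; exact: differentiableM.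
rewrite !sprodE -big_split; apply: eq_bigr => i _ /=.
rewrite -mulrDr (derive_entry v i dX) (derive_entry v i dY).
have dd : derivable (fun q : V => X q 0 i * Y q 0 i) p v.
  by apply: diff_derivable; exact: differentiableM.
rewrite [LHS](deriveZ (sgnat i) dd); congr (_ * _).
rewrite [LHS]deriveM; [|exact: diff_derivable..].
by rewrite addrC -![_ *: _]/(_ * _) [Y p 0 i * _]mulrC.
Qed.

End Derivatives.
End ScalarProduct.

(** * Quadrics <y, y> = - kappa *)

Section PseudoSphere.
Context {R : realType} {m N : nat} (n : nat) (kappa : R) (S : set 'rV[R]_N).
Context (hN : N = m.+1) (k0 : kappa != 0)
  (hS : S `<=` [set y | sprod n y y = - kappa]) (c : chart m S).

Local Notation Y := (par c).
Local Notation K := (coo c).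
Local Notation b := (sprod n).
Local Notation G := (pullback_metric (sprod n) (par c)).
Implicit Types (u v w : 'rV[R]_m) (V W : 'rV[R]_N).

Lemma open_dom : open (dom c).
Proof. exact: dom_open. Qed.

Lemma par_quadric u : dom c u -> b (Y u) (Y u) = - kappa.
Proof. by move=> /par_in[/hS]. Qed.

Lemma par_diff u : dom c u -> differentiable Y u.
Proof. exact: smooth_differentiable (par_smooth c). Qed.

Lemma par_smoothD v : smooth_on (dom c) ('D_v Y).
Proof. exact/smooth_derive/par_smooth. Qed.

Lemma par_diffD v u : dom c u -> differentiable ('D_v Y) u.
Proof. exact: smooth_differentiable (par_smoothD v). Qed.

Lemma par_diffDD v w u : dom c u -> differentiable ('D_v ('D_w Y)) u.
Proof. exact/smooth_differentiable/smooth_derive/par_smoothD. Qed.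

Lemma coo_diff u : dom c u -> differentiable K (Y u).
Proof. by move=> /par_in[_ nu]; exact: smooth_differentiable (coo_smooth c) nu. Qed.

Lemma coo_diffD u V : dom c u -> differentiable ('D_V K) (Y u).
Proof.
by move=> /par_in[_ nu]; apply: smooth_differentiable nu; exact/smooth_derive/coo_smooth.
Qed.

Lemma coo_derive u v : dom c u -> 'D_('D_v Y u) K (Y u) = v.
Proof.
move=> du; rewrite -(derive_comp v (par_diff du) (coo_diff du)).
rewrite (derive_eq_on (g := id) v open_dom du) ?derive_id // => y dy.
exact: parK.
Qed.

Lemma par_derive_inj u v w : dom c u -> 'D_v Y u = 'D_w Y u -> v = w.
Proof. by move=> du vw; rewrite -(coo_derive v du) vw coo_derive. Qed.

Lemma par_tangent u v : dom c u -> b ('D_v Y u) (Y u) = 0.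
Proof.
move=> du; have dY := par_diff du.
have : 'D_v (fun y => b (Y y) (Y y)) u = 0.
  rewrite (derive_eq_on (g := fun=> - kappa) v open_dom du) ?derive_cst // => y dy.
  exact: par_quadric.
rewrite derive_sprod // [X in _ + X]sprodC -mulr2n => /eqP.
by rewrite mulrn_eq0 /= => /eqP.
Qed.

Lemma par_second u v w : dom c u ->
  b ('D_v ('D_w Y) u) (Y u) = - b ('D_v Y u) ('D_w Y u).
Proof.
move=> du; apply/eqP; rewrite -addr_eq0 [X in _ + X]sprodC.
have <- := derive_sprod n v (par_diffD w du) (par_diff du).
rewrite (derive_eq_on (g := fun=> 0) v open_dom du) ?derive_cst // => y dy.
exact: par_tangent.
Qed.

(** The image of the differential of Y is contained in the hyperplane
    orthogonal to Y u, and both have dimension m. *)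
Lemma tangent_space u V : dom c u -> b V (Y u) = 0 -> exists v, V = 'D_v Y u.
Proof.
move=> du bV; pose A := \matrix_i 'D_(frame i) Y u.
have AE v : v *m A = 'D_v Y u.
  rewrite (derive_frames v (par_diff du)) mulmx_sum_row.
  by apply: eq_bigr => i _; rewrite rowK.
(* V *m C is the scalar product of V with Y u. *)
pose C := (\row_i (sgnat n i * Y u 0 i) : 'rV[R]_N)^T.
have A_free : row_free A.
  apply: inj_row_free => v; rewrite AE => v0; apply: (par_derive_inj du).
  by rewrite v0 derive0.
have C0 : C != 0.
  apply: contraNneq k0 => C0; rewrite -oppr_eq0 -(par_quadric du) sprod_mul.
  by rewrite -/C C0 mulmx0 mxE.
have rC : \rank C = 1%N.
  by apply/eqP; rewrite eqn_leq rank_leq_col lt0n mxrank_eq0.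
have AK : (A <= kermx C)%MS.
  apply/sub_kermxP/row_matrixP => i; rewrite row_mul rowK row0.
  by apply/rowP => j; rewrite ord1 -sprod_mul par_tangent // mxE.
have KA : (kermx C <= A)%MS.
  rewrite -(mxrank_leqif_sup AK) mxrank_ker rC.
  by rewrite (_ : (N - 1)%N = m) // hN subn1.
have VA : (V <= A)%MS.
  apply: submx_trans KA; apply/sub_kermxP/rowP => j.
  by rewrite ord1 -sprod_mul bV mxE.
by have /submxP[v ->] := VA; exists v; rewrite AE.
Qed.

(** Tangent vectors and Y u span the ambient space, whose form is
    nondegenerate. *)
Lemma moving_frame_nondegenerate u V : dom c u -> b V (Y u) = 0 ->
  (forall v, b V ('D_v Y u) = 0) -> V = 0.
Proof.
move=> du bY bV; apply: (@sprod_nondegenerate _ n) => W.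
pose t := - kappa^-1 * b W (Y u).
have [v vE] : exists v, W - t *: Y u = 'D_v Y u.
  apply: (tangent_space du); rewrite sprodBl sprodZl par_quadric //.
  by rewrite /t; field.
by rewrite -[W](subrK (t *: Y u)) vE linearD linearZ /= bY mulr0 addr0 bV.
Qed.

Lemma metric_entry u i j : G u i j = b ('D_(frame i) Y u) ('D_(frame j) Y u).
Proof. by rewrite mxE. Qed.

Lemma metric_mul u v w : dom c u ->
  (v *m G u *m w^T) 0 0 = b ('D_v Y u) ('D_w Y u).
Proof.
move=> du; rewrite (derive_frames v (par_diff du)) (derive_frames w (par_diff du)).
rewrite linear_sum mxE; apply: eq_bigr => j _.
rewrite linearZ /= sprodC linear_sum /= mxE mulr_suml mulr_sumr.
apply: eq_bigr => i _; rewrite linearZ /= !mxE sprodC.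
by ring.
Qed.

Lemma pullback_metric_sym u : (G u)^T = G u.
Proof. by apply/matrixP => i j; rewrite !mxE sprodC. Qed.

Lemma metric_unit u : dom c u -> G u \in unitmx.
Proof.
move=> du; rewrite -row_free_unit; apply: inj_row_free => v v0.
apply: (par_derive_inj du); rewrite derive0.
apply: (moving_frame_nondegenerate du (par_tangent v du)) => w.
by rewrite -metric_mul // v0 mul0mx mxE.
Qed.

Lemma metric_derive u k i j : dom c u ->
  'D_(frame k) (fun z => G z i j) u =
    b ('D_(frame k) ('D_(frame i) Y) u) ('D_(frame j) Y u)
    + b ('D_(frame i) Y u) ('D_(frame k) ('D_(frame j) Y) u).
Proof.
move=> du; under [X in 'D__ X u]eq_fun do rewrite metric_entry.
by apply: derive_sprod; exact: par_diffD.
Qed.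

(** Koszul formula: the derivatives of the metric are scalar products of first
    and second derivatives of Y, and they add up to twice the one on the right
    because second derivatives commute. *)
Lemma christoffel_lower u i j l : dom c u ->
  \sum_k christoffel G i j k u * G u k l =
    b ('D_(frame i) ('D_(frame j) Y) u) ('D_(frame l) Y u).
Proof.
move=> du; pose d l := 'D_(frame i) (fun z => G z j l) u
  + 'D_(frame j) (fun z => G z i l) u - 'D_(frame l) (fun z => G z i j) u.
transitivity (2^-1 * d l).
  rewrite -[d l](_ : \sum_l' d l' * (G u *m invmx (G u)) l l' = _); last first.
    rewrite mulmxV ?metric_unit // (bigD1 l) //= big1 ?addr0 => [|l' l'l].
      by rewrite mxE eqxx mulr1.
    by rewrite mxE eq_sym (negPf l'l) mulr0.
  under [X in _ = _ * X]eq_bigr do rewrite mxE mulr_sumr.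
  rewrite exchange_big mulr_sumr; apply: eq_bigr => k _ /=.
  rewrite /christoffel -mulrA; congr (_ * _); rewrite mulr_suml.
  apply: eq_bigr => l' _; rewrite -/(d l').
  have -> : G u k l = G u l k by rewrite -[G u in LHS]pullback_metric_sym mxE.
  by rewrite mulrAC mulrC [_ * G u l k]mulrC.
(* Z and T stand for the second and first derivatives of Y. *)
have key (Z : 'I_m -> 'I_m -> 'rV[R]_N) (T : 'I_m -> 'rV[R]_N) :
    (forall a a', Z a a' = Z a' a) ->
    2^-1 * (b (Z i j) (T l) + b (T j) (Z i l) + (b (Z j i) (T l) + b (T i) (Z j l))
            - (b (Z l i) (T j) + b (T i) (Z l j))) = b (Z i j) (T l).
  move=> sw; rewrite (sw j i) (sw l i) (sw l j) (sprodC _ (T j)).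
  by field.
apply: etrans (key (fun a a' => 'D_(frame a) ('D_(frame a') Y) u)
                   (fun a => 'D_(frame a) Y u) _); last first.
  by move=> a a'; exact: schwarz open_dom du (par_smooth c).
by congr (_ * _); congr (_ + _ - _); exact: metric_derive.
Qed.

(** Both sides are orthogonal to Y u, and they have the same scalar products
    with the coordinate vectors by the Koszul formula. *)
Lemma gauss_formula u i j : dom c u ->
  \sum_k christoffel G i j k u *: 'D_(frame k) Y u =
  'D_(frame i) ('D_(frame j) Y) u - (kappa^-1 * G u i j) *: Y u.
Proof.
move=> du; apply/eqP; rewrite -subr_eq0; apply/eqP.
set L := \sum_k _; set T := _ - _ *: _.
have LE (w : 'rV[R]_N) : b L w = \sum_k christoffel G i j k u * b ('D_(frame k) Y u) w.
  by rewrite sprodC linear_sum; apply: eq_bigr => k _; rewrite linearZ /= sprodC.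
apply: (moving_frame_nondegenerate du) => [|v].
  rewrite sprodBl LE big1 => [|k _]; last by rewrite par_tangent // mulr0.
  rewrite sprodBl sprodZl par_second // par_quadric // metric_entry.
  by rewrite mulrN mulrAC mulVf // mul1r opprK addNr subr0.
rewrite (derive_frames v (par_diff du)) linear_sum big1 // => l _.
rewrite linearZ /= sprodBl LE.
under eq_bigr do rewrite -metric_entry.
rewrite christoffel_lower // sprodBl sprodZl [b (Y u) _]sprodC par_tangent //.
by rewrite mulr0 subr0 subrr mulr0.
Qed.

(** Here s is a section of the pull-back of the tangent bundle along f, and T is
    the ambient vector field that it represents. *)
Section PullBack.
Context {q : nat} (O : set 'rV[R]_q) (f : 'rV[R]_q -> 'rV[R]_m).
Context (oO : open O) (fO : forall x, O x -> dom c (f x))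
  (df : forall x, O x -> differentiable f x).
Context (s : 'rV[R]_q -> 'rV[R]_m) (T : 'rV[R]_q -> 'rV[R]_N).
Context (sT : forall x, O x -> 'D_(s x) Y (f x) = T x).

(** The coordinates s are recovered from T by the derivative of the smooth
    left inverse K of Y. This spares the differentiation of Christoffel symbols
    and of inverse matrices when s is itself defined by a connection. *)
Lemma lift_differentiable x : O x -> differentiable T x -> differentiable s x.
Proof.
move=> Ox dT; have dY := par_diff (fO Ox).
apply: (differentiable_eq_on (f := fun y => \sum_(k < N)
  T y 0 k *: 'D_(frame k) K (Y (f y))) oO Ox).
  move=> y Oy; rewrite -(derive_frames (T y) (coo_diff (fO Oy))) -sT //.
  by rewrite coo_derive //; exact: fO.
apply: differentiable_sumE => k; apply: differentiable_scale.
  exact: differentiable_entry.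
apply: (@differentiable_comp _ _ _ _ (fun y => Y (f y)) ('D_(frame k) K)).
  exact: (differentiable_comp (df Ox) dY).
exact/coo_diffD/fO.
Qed.

(** By the chain rule, the derivative of T is the image of the derivative of s
    plus a combination of second derivatives of Y; the Gauss formula turns the
    Christoffel terms into the latter, up to a multiple of Y. *)
Lemma pbnabla_lift X x : O x -> differentiable T x ->
  'D_(pbnabla G f X s x) Y (f x) = 'D_(X x) T x
    - (kappa^-1 * b ('D_('D_(X x) f x) Y (f x)) (T x)) *: Y (f x).
Proof.
move=> Ox dT; have dfx := fO Ox; have ds := lift_differentiable Ox dT.
have dY := par_diff dfx; set v := 'D_(X x) f x.
have -> : 'D_(X x) T x = 'D_('D_(X x) s x) Y (f x)
    + \sum_j s x 0 j *: 'D_v ('D_(frame j) Y) (f x).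
  have dYf j : differentiable (fun y => 'D_(frame j) Y (f y)) x.
    exact: differentiable_comp (df Ox) (par_diffD (frame j) dfx).
  rewrite -(derive_eq_on (X x) oO Ox sT).
  rewrite (derive_eq_on (g := fun y => \sum_(j < m) s y 0 j *: 'D_(frame j) Y (f y))
    (X x) oO Ox); last by move=> y Oy; exact/derive_frames/par_diff/fO.
  rewrite derive_sumE => [|j]; last first.
    by apply/diff_derivable/differentiable_scale => //; exact: differentiable_entry.
  rewrite (derive_frames _ dY) -big_split; apply: eq_bigr => j _ /=.
  apply: etrans (derive_scale (X x) (differentiable_entry j ds) (dYf j)) _.
  have E1 : 'D_(X x) (fun y => s y 0 j) x = ('D_(X x) s x) 0 j.
    exact: esym (derive_entry (X x) j ds).
  have E2 : 'D_(X x) (fun y => 'D_(frame j) Y (f y)) x = 'D_v ('D_(frame j) Y) (f x).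
    exact: derive_comp (X x) (df Ox) (par_diffD (frame j) dfx).
  by rewrite E1 E2.
rewrite /pbnabla -/v deriveDv // -addrA; congr (_ + _).
transitivity (\sum_j \sum_i (v 0 i * s x 0 j) *:
    \sum_k christoffel G i j k (f x) *: 'D_(frame k) Y (f x)).
  rewrite (derive_frames _ dY).
  under eq_bigr => k _.
    rewrite mxE exchange_big scaler_suml.
    under eq_bigr => j _.
      rewrite scaler_suml.
      under eq_bigr => i _ do rewrite -mulrA mulrC -scalerA.
    over.
  over.
  rewrite exchange_big; apply: eq_bigr => j _.
  rewrite exchange_big; apply: eq_bigr => i _ /=.
  by rewrite scaler_sumr.
have -> : b ('D_v Y (f x)) (T x) = \sum_j \sum_i (v 0 i * s x 0 j) * G (f x) i j.
  rewrite -sT // (derive_frames (s x) dY) linear_sum; apply: eq_bigr => j _.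
  rewrite linearZ /= sprodC (derive_frames v dY) linear_sum mulr_sumr.
  by apply: eq_bigr => i _; rewrite linearZ /= metric_entry sprodC; ring.
rewrite mulr_sumr scaler_suml -sumrB; apply: eq_bigr => j _.
rewrite (derive_frames v (par_diffD (frame j) dfx)) scaler_sumr mulr_sumr.
rewrite scaler_suml -sumrB; apply: eq_bigr => i _.
rewrite gauss_formula // scalerBr !scalerA; congr (_ *: _ - _ *: _); ring.
Qed.

End PullBack.

Lemma nabla_cst_lift v w u : dom c u ->
  'D_(nabla G (cst v) (cst w) u) Y u =
  'D_v ('D_w Y) u - (kappa^-1 * b ('D_v Y u) ('D_w Y u)) *: Y u.
Proof.
move=> du; have := @pbnabla_lift m (dom c) id open_dom (fun _ => id)
  (fun y _ => @ex_diff _ _ _ _ _ _ _ (is_diff_id y)) (cst w) ('D_w Y) (fun _ _ => erefl) (cst v) u du.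
by rewrite derive_id; apply; exact: par_diffD.
Qed.

Lemma nabla_zero (X Z : 'rV[R]_m -> 'rV[R]_m) u : X u = 0 -> nabla G X Z u = 0.
Proof.
move=> X0; apply/rowP => k; rewrite /nabla /pbnabla X0 !derive0 add0r !mxE.
by rewrite big1 // => i _; rewrite big1 // => j _; rewrite mxE mulr0 mul0r.
Qed.

(** Third derivatives of Y cancel by symmetry; so do the normal components,
    whose coefficient is the symmetric expression
    <Y_vw, Y_z> + <Y_w, Y_vz> + <Y_v, Y_wz>. What remains comes from the
    derivative of Y in the projected term of [nabla_cst_lift]. *)
Lemma curvature_lift u v w z : dom c u ->
  'D_(curvature G u v w z) Y u =
    (kappa^-1 * b ('D_v Y u) ('D_z Y u)) *: 'D_w Y u
    - (kappa^-1 * b ('D_w Y u) ('D_z Y u)) *: 'D_v Y u.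
Proof.
move=> du; pose H w y := 'D_w ('D_z Y) y
  - (kappa^-1 * b ('D_w Y y) ('D_z Y y)) *: Y y.
have db w' : differentiable (fun y => kappa^-1 * b ('D_w' Y y) ('D_z Y y)) u.
  by apply: differentiableM => //; apply: differentiable_sprod; exact: par_diffD.
have dH w' : differentiable (H w') u.
  apply: differentiableB; first exact: par_diffDD.
  by apply: differentiable_scale; [exact: db|exact: par_diff].
have DH v' w' : 'D_v' (H w') u = 'D_v' ('D_w' ('D_z Y)) u
    - ((kappa^-1 * (b ('D_v' ('D_w' Y) u) ('D_z Y u)
                    + b ('D_w' Y u) ('D_v' ('D_z Y) u))) *: Y u
       + (kappa^-1 * b ('D_w' Y u) ('D_z Y u)) *: 'D_v' Y u).
  rewrite deriveB; [|apply: diff_derivable..]; last 2 first.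
  - exact: par_diffDD.
  - by apply: differentiable_scale; [exact: db|exact: par_diff].
  rewrite derive_scale //; last exact: par_diff.
  have dd : differentiable (fun y => b ('D_w' Y y) ('D_z Y y)) u.
    by apply: differentiable_sprod; exact: par_diffD.
  have E : 'D_v' (fun y => kappa^-1 * b ('D_w' Y y) ('D_z Y y)) u =
      kappa^-1 * (b ('D_v' ('D_w' Y) u) ('D_z Y u)
                  + b ('D_w' Y u) ('D_v' ('D_z Y) u)).
    apply: etrans (derive_mull v' kappa^-1 dd) _.
    apply: (congr1 ( *%R (kappa^-1))).
    exact: derive_sprod (par_diffD w' du) (par_diffD z du).
  by rewrite E.
have NN v' w' : 'D_(nabla G (cst v') (nabla G (cst w') (cst z)) u) Y u =
    'D_v' (H w') u - (kappa^-1 * b ('D_v' Y u) (H w' u)) *: Y u.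
  have := @pbnabla_lift m (dom c) id open_dom (fun _ => id)
    (fun y _ => @ex_diff _ _ _ _ _ _ _ (is_diff_id y)) (nabla G (cst w') (cst z)) (H w')
    (fun y dy => nabla_cst_lift w' z dy) (cst v') u du (dH w').
  by rewrite derive_id.
rewrite /curvature /riemann (nabla_zero (X := lie_bracket _ _)); last first.
  by rewrite /lie_bracket /= !derive_cst subrr.
(* The remaining algebra: A, A' are third derivatives, X, X', zv, zw second
   derivatives, and yv, yw, yz first derivatives of Y at u. *)
have key (A A' X X' yv yw yz zv zw y : 'rV[R]_N) :
    A = A' -> X = X' -> b yv y = 0 -> b yw y = 0 ->
    (A - ((kappa^-1 * (b X yz + b yw zv)) *: y + (kappa^-1 * b yw yz) *: yv)
       - (kappa^-1 * b yv (zw - (kappa^-1 * b yw yz) *: y)) *: y)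
    - (A' - ((kappa^-1 * (b X' yz + b yv zw)) *: y + (kappa^-1 * b yv yz) *: yw)
          - (kappa^-1 * b yw (zv - (kappa^-1 * b yv yz) *: y)) *: y)
    = (kappa^-1 * b yv yz) *: yw - (kappa^-1 * b yw yz) *: yv.
  move=> -> -> bv bw; rewrite !sprodBr !sprodZr bv bw !mulr0 !subr0.
  by apply/rowP => i; rewrite !mxE; ring.
rewrite subr0; apply: etrans (deriveBv _ _ (par_diff du)) _.
have E v' w' := etrans (NN v' w')
  (congr1 (fun V => V - (kappa^-1 * b ('D_v' Y u) (H w' u)) *: Y u) (DH v' w')).
apply: etrans (congr2 (fun V W : 'rV[R]_N => V - W) (E v w) (E w v)) _.
apply: key; [|exact: schwarz open_dom du (par_smooth c)|exact: par_tangent..].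
exact: schwarz open_dom du (par_smoothD z).
Qed.

End PseudoSphere.

(** * The map y |-> (y, r) *)

Section AddConstant.
Context {R : realType} {V : normedModType R} {K q : nat}.
Implicit Types (X : V -> 'rV[R]_K) (a : 'rV[R]_q).

Lemma differentiable_row_mx X a u : differentiable X u ->
  differentiable (fun t => row_mx (X t) a) u.
Proof.
move=> dX; apply: differentiable_row => j; under eq_fun do rewrite mxE.
by case: (fintype.split j) => [k|k] /=; [exact: differentiable_entry|].
Qed.

Lemma derive_row_mx X a u v : differentiable X u ->
  'D_v (fun t => row_mx (X t) a) u = row_mx ('D_v X u) 0.
Proof.
move=> dX; apply/rowP => j; rewrite (derive_entry v j (differentiable_row_mx a dX)).
rewrite mxE; under [X in 'D_v X u]eq_fun do rewrite mxE.
case: (fintype.split j) => [k|k] /=; first by rewrite (derive_entry v k dX).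
by rewrite derive_cst mxE.
Qed.

Lemma Ck_row_mx k U X a : open U -> Ck k U X -> Ck k U (fun t => row_mx (X t) a).
Proof.
move=> oU CX; apply: Ck_row => // j; under eq_fun do rewrite mxE.
by case: (fintype.split j) => [i|i] /=; [exact: Ck_entry|exact: Ck_cst].
Qed.

End AddConstant.

Lemma sprod_row_mx {R : realType} (n K q : nat) (x y : 'rV[R]_K) (a b : 'rV[R]_q) :
  (n <= K)%N ->
  sprod n (row_mx x a) (row_mx y b) = sprod n x y - \sum_i a 0 i * b 0 i.
Proof.
move=> nK; rewrite /sprod big_split_ord /= -sumrN; congr (_ + _).
  by apply: eq_bigr => i _; rewrite !row_mxEl.
apply: eq_bigr => i _; rewrite !row_mxEr ifF //.
by apply/negbTE; rewrite -leqNgt (leq_trans nK) ?leq_addr.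
Qed.

(** The dimensions are related by propositional equations because n + 1, the
    length of the ambient vectors, is not convertible to n.+1. *)
Section SmallSphere.
Context {R : realType} {n m p K : nat} (r : R) (S : set 'rV[R]_K)
  (T : set 'rV[R]_(K + 1)).
Context (hK : K = m.+1) (hp : (K + 1)%N = p.+1) (nK : (n <= K)%N)
  (r2 : r ^+ 2 = 2^-1)
  (hS : S `<=` [set y | sprod n y y = - r ^+ 2])
  (hT : T `<=` [set x | sprod n x x = -1])
  (ST : forall y, S y -> T (row_mx y (const_mx r)))
  (c : chart m S) (d : chart p T).

Let phi (y : 'rV[R]_K) : 'rV[R]_(K + 1) := row_mx y (const_mx r).
Local Notation X := (par c).
Local Notation Y := (par d).
Local Notation b := (sprod n).
Local Notation g := (pullback_metric (sprod n) (par c)).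
Local Notation G := (pullback_metric (sprod n) (par d)).
Let F (u : 'rV[R]_m) : 'rV[R]_(K + 1) := phi (par c u).
Let f : 'rV[R]_m -> 'rV[R]_p := coo d \o phi \o par c.
Let O := [set u | dom c u /\ nbh d (F u)].
Let xi (u : 'rV[R]_m) : 'rV[R]_(K + 1) := row_mx (X u) (const_mx (- r)).

Let k0 : r ^+ 2 != 0.
Proof. by rewrite r2 invr_eq0 pnatr_eq0. Qed.

Let oneK : (1 : R) != 0.
Proof. exact: oner_neq0. Qed.

Lemma image_diff u : dom c u -> differentiable F u.
Proof. by move=> du; exact/differentiable_row_mx/par_diff. Qed.

Lemma overlap_open : open O.
Proof.
rewrite openE => u [du nu]; apply: filterI.
  exact: open_nbhs_nbhs (conj (open_dom (c:=c)) du).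
apply: (differentiable_continuous (image_diff du)).
exact: open_nbhs_nbhs (conj (@nbh_open _ _ _ _ d) nu).
Qed.

Lemma image_derive v u : dom c u -> 'D_v F u = row_mx ('D_v X u) 0.
Proof. by move=> du; exact/derive_row_mx/par_diff. Qed.

Lemma image_diffD v u : dom c u -> differentiable ('D_v F) u.
Proof.
move=> du.
apply: (differentiable_eq_on (f := fun t => row_mx ('D_v X t) 0) (open_dom (c:=c)) du).
  by move=> t dt; rewrite image_derive.
exact/differentiable_row_mx/par_diffD.
Qed.

Lemma image_derive2 v w u : dom c u ->
  'D_v ('D_w F) u = row_mx ('D_v ('D_w X) u) 0.
Proof.
move=> du; rewrite -(derive_row_mx 0 v (par_diffD w du)).
by apply: (derive_eq_on v (open_dom (c:=c)) du) => t dt; rewrite image_derive.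
Qed.

Lemma normal_diff u : dom c u -> differentiable xi u.
Proof. by move=> du; exact/differentiable_row_mx/par_diff. Qed.

Lemma normal_derive v u : dom c u -> 'D_v xi u = 'D_v F u.
Proof. by move=> du; rewrite image_derive //; exact/derive_row_mx/par_diff. Qed.

Lemma image_in u : dom c u -> T (F u).
Proof. by move=> /par_in[/ST]. Qed.

Lemma image_coord u : O u -> Y (f u) = F u.
Proof. by move=> [du nu]; apply: cooK; split => //; exact: image_in. Qed.

Lemma coord_dom u : O u -> dom d (f u).
Proof. by move=> [du nu]; apply: coo_in; split => //; exact: image_in. Qed.

Lemma coord_diff u : O u -> differentiable f u.
Proof.
move=> Ou; have [du nu] := Ou.
apply: (@differentiable_comp _ _ _ _ F (coo d)); first exact: image_diff.
exact: smooth_differentiable (coo_smooth d) nu.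
Qed.

Lemma push_lift v u : O u -> 'D_('D_v f u) Y (f u) = 'D_v F u.
Proof.
move=> Ou; rewrite -(derive_comp v (coord_diff Ou) (par_diff (coord_dom Ou))).
exact: derive_eq_on overlap_open Ou image_coord.
Qed.

Lemma image_isometric v w u : dom c u ->
  b ('D_v F u) ('D_w F u) = b ('D_v X u) ('D_w X u).
Proof.
move=> du; rewrite !image_derive // sprod_row_mx // big1 ?subr0 // => i _.
by rewrite mxE mul0r.
Qed.

Lemma normal_orthogonal v u : dom c u -> b (xi u) ('D_v F u) = 0.
Proof.
move=> du; rewrite image_derive // sprod_row_mx // sprodC (par_tangent hS) // big1 ?subr0 //.
by move=> i _; rewrite !mxE mulr0.
Qed.

(** In the ambient space, this is the projection (X_vw, 0) - g_vw F of the
    second derivative of F, minus the image (X_vw - 2 g_vw X, 0) of the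
    connection of H, where 2 is 1 / r ^ 2. *)
Lemma second_form v w u : O u ->
  'D_(nabla_d g G f (cst v) (cst w) u) Y (f u) = b ('D_v X u) ('D_w X u) *: xi u.
Proof.
move=> Ou; have [du _] := Ou; have dfu := coord_dom Ou.
rewrite /nabla_d; apply: etrans (deriveBv _ _ (par_diff dfu)) _.
have E1 : 'D_(pbnabla G f (cst v) (push f (cst w)) u) Y (f u) =
    'D_v ('D_w F) u - b ('D_v F u) ('D_w F u) *: F u.
  have := @pbnabla_lift _ _ _ n 1 T hp oneK hT d m O f overlap_open coord_dom coord_diff
    (push f (cst w)) ('D_w F) (push_lift w) (cst v) u Ou (image_diffD w du).
  by rewrite invr1 mul1r push_lift // image_coord.
have E2 : 'D_(push f (nabla g (cst v) (cst w)) u) Y (f u) =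
    row_mx ('D_v ('D_w X) u - (2 * b ('D_v X u) ('D_w X u)) *: X u) 0.
  rewrite [LHS]push_lift // image_derive // (nabla_cst_lift hK k0 hS v w du).
  by rewrite r2 invrK.
apply: etrans (congr2 (fun V W : 'rV[R]_(K + 1) => V - W) E1 E2) _.
rewrite image_derive2 // image_isometric // /F /xi /phi.
rewrite scale_row_mx !(opp_row_mx, add_row_mx) scale_row_mx; congr row_mx.
  by apply/rowP => i; rewrite !mxE; ring.
by apply/rowP => i; rewrite !mxE; ring.
Qed.

Lemma trace_metric q (B : 'rV[R]_m -> 'rV[R]_m -> 'rV[R]_q) t u : dom c u ->
  (forall i j, B (frame i) (frame j) =
     b ('D_(frame i) X u) ('D_(frame j) X u) *: t) ->
  trace g u B = m%:R *: t.
Proof.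
move=> du BE; rewrite /trace.
under eq_bigr do under eq_bigr do
  rewrite BE -metric_entry scalerA.
under eq_bigr do rewrite -scaler_suml.
rewrite -scaler_suml; congr (_ *: _).
transitivity (\tr (invmx (g u) *m (g u)^T)).
  by apply: eq_bigr => i _; rewrite mxE; apply: eq_bigr => j _; rewrite [_^T _ _]mxE.
by rewrite pullback_metric_sym mulVmx ?mxtrace1 // (metric_unit hK k0 hS).
Qed.

Lemma tension_lift u : O u ->
  'D_(tension g G f u) Y (f u) = m%:R *: xi u.
Proof.
move=> Ou; have [du _] := Ou.
pose B v w := 'D_(nabla_d g G f (cst v) (cst w) u) Y (f u).
rewrite -(@trace_metric _ B (xi u) u du); last by move=> i j; exact: second_form.
have dY := par_diff (coord_dom Ou).
have linY q (h : 'I_q -> 'rV[R]_p) : 'D_(\sum_i h i) Y (f u) = \sum_i 'D_(h i) Y (f u).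
  by rewrite deriveE // linear_sum; apply: eq_bigr => i _; rewrite deriveE.
rewrite /tension /trace linY; apply: eq_bigr => i _.
by rewrite linY; apply: eq_bigr => j _; rewrite deriveZv.
Qed.

(** The derivative of xi is that of F, which is already tangent. *)
Lemma nabla_tension (V : 'rV[R]_m -> 'rV[R]_m) u : O u ->
  pbnabla G f V (tension g G f) u = m%:R *: 'D_(V u) f u.
Proof.
move=> Ou; have [du _] := Ou; have dfu := coord_dom Ou.
apply: (par_derive_inj dfu); rewrite deriveZv ?push_lift //; last exact: par_diff.
have dxi : differentiable (fun t => m%:R *: xi t) u.
  by apply: differentiableZ; exact: normal_diff.
have := @pbnabla_lift _ _ _ n 1 T hp oneK hT d m O f overlap_open coord_dom coord_diff
    (tension g G f) (fun t => m%:R *: xi t) tension_lift V u Ou dxi.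
rewrite push_lift // sprodZr sprodC normal_orthogonal // !mulr0 scale0r subr0.
rewrite [X in _ = X -> _]deriveZ ?normal_derive //.
exact/diff_derivable/normal_diff.
Qed.

Lemma nabla2_tension v w u : O u ->
  pbnabla G f (cst v) (pbnabla G f (cst w) (tension g G f)) u
    - pbnabla G f (nabla g (cst v) (cst w)) (tension g G f) u
  = m%:R *: nabla_d g G f (cst v) (cst w) u.
Proof.
move=> Ou; have [du _] := Ou; have dfu := coord_dom Ou; have dY := par_diff dfu.
rewrite nabla_tension // /nabla_d scalerBr; congr (_ - _).
apply: (par_derive_inj dfu); rewrite deriveZv //.
have dF : differentiable (fun t => m%:R *: 'D_w F t) u.
  by apply: differentiableZ; exact: image_diffD.
have sE t : O t ->
    'D_(pbnabla G f (cst w) (tension g G f) t) Y (f t) = m%:R *: 'D_w F t.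
  move=> Ot; rewrite nabla_tension // deriveZv ?push_lift //.
  exact/par_diff/coord_dom.
have := @pbnabla_lift _ _ _ n 1 T hp oneK hT d m O f overlap_open coord_dom coord_diff
    _ _ sE (cst v) u Ou dF.
have := @pbnabla_lift _ _ _ n 1 T hp oneK hT d m O f overlap_open coord_dom coord_diff
    (push f (cst w)) ('D_w F) (push_lift w) (cst v) u Ou (image_diffD w du).
rewrite invr1 !mul1r => -> ->.
rewrite scalerBr scalerA sprodZr; congr (_ - _).
by apply: deriveZ; exact/diff_derivable/image_diffD.
Qed.

(** The Hessian of the tension contributes m tau, and so does the curvature
    term, as tau is orthogonal to the image of dF. *)
Lemma bitension_eq0 u : O u -> bitension g G f u = 0.
Proof.
move=> Ou; have [du _] := Ou; have dfu := coord_dom Ou; have dY := par_diff dfu.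
rewrite /bitension /rough_laplacian opprK.
have -> : trace g u (fun v w => pbnabla G f (cst v) (pbnabla G f (cst w) (tension g G f)) u
    - pbnabla G f (nabla g (cst v) (cst w)) (tension g G f) u)
  = m%:R *: tension g G f u.
  rewrite /trace scaler_sumr; apply: eq_bigr => i _.
  rewrite scaler_sumr; apply: eq_bigr => j _.
  by rewrite nabla2_tension // !scalerA mulrC.
apply/eqP; rewrite subr_eq0; apply/eqP/esym; apply: trace_metric => // i j.
apply: (par_derive_inj dfu); rewrite (curvature_lift hp oneK hT) // deriveZv //.
have key (A A' B B' C x : 'rV[R]_(K + 1)) (t : R) :
    A = A' -> B = B' -> C = m%:R *: x -> b x B' = 0 -> b A' B' = t ->
    (1^-1 * b A B) *: C - (1^-1 * b C B) *: A = t *: C.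
  move=> -> -> -> xB ->; rewrite [b (_ *: _) _]sprodZl xB !mulr0 scale0r subr0.
  by rewrite invr1 mul1r.
exact: (key _ _ _ _ _ _ _ (push_lift (frame i) Ou) (push_lift (frame j) Ou)
  (tension_lift Ou) (normal_orthogonal (frame j) du) (image_isometric (frame i) (frame j) du)).
Qed.

(** The last coordinate of m xi is - m r. *)
Lemma tension_neq0 u : (0 < m)%N -> O u -> tension g G f u != 0.
Proof.
move=> m0 Ou; apply/eqP => t0; have := tension_lift Ou.
rewrite t0 derive0 => /rowP /(_ (rshift K ord0)) /eqP.
rewrite !mxE (unsplitK (inr ord0)) mxE eq_sym mulf_eq0 oppr_eq0 pnatr_eq0.
have /negPf-> : r != 0 by apply: contraNneq k0 => ->; rewrite expr0n.
by rewrite orbF eqn0Ngt m0.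
Qed.

End SmallSphere.

(** * Charts of a quadric *)

(** The part of the quadric where the coordinate k, of negative sign in the form,
    has the sign sg is the graph of sg * sqrt (kappa + q), where q is the form in
    the other coordinates. *)
Section GraphChart.
Context {R : realType} (n : nat) {m : nat} (kappa : R) (k : 'I_m.+1) (sg : R).
Context (nk : (n <= k)%N) (sg2 : sg * sg = 1).

Let b := (@sprod R n m.+1).
Let q (u : 'rV[R]_m) : R := \sum_(j < m) sgnat n (lift k j) * (u 0 j * u 0 j).
Let D : set 'rV[R]_m := [set u | 0 < kappa + q u].
Let E : set 'rV[R]_m.+1 := [set y | 0 < sg * y 0 k].
Let P (u : 'rV[R]_m) : 'rV[R]_m.+1 :=
  \row_i (if unlift k i is Some j then u 0 j else sg * Num.sqrt (kappa + q u)).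
Let C (y : 'rV[R]_m.+1) : 'rV[R]_m := \row_j y 0 (lift k j).

Lemma sprod_coord (y : 'rV[R]_m.+1) : b y y = q (C y) - y 0 k * y 0 k.
Proof.
rewrite /b sprodE (bigD1_ord k) //= addrC; congr (_ + _); last first.
  by rewrite /sgnat ltnNge nk mulN1r.
by apply: eq_bigr => j _; rewrite !mxE.
Qed.

Lemma graph_coord u : P u 0 k = sg * Num.sqrt (kappa + q u).
Proof. by rewrite mxE unlift_none. Qed.

Lemma graphK u : C (P u) = u.
Proof. by apply/rowP => j; rewrite !mxE liftK. Qed.

Lemma graph_quadric u : D u -> b (P u) (P u) = - kappa.
Proof.
move=> Du; rewrite sprod_coord graphK graph_coord mulrACA sg2 mul1r -expr2.
by rewrite sqr_sqrtr ?ltW //; ring.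
Qed.

Lemma graph_side u : D u -> E (P u).
Proof. by move=> Du; rewrite /E /= graph_coord mulrA sg2 mul1r sqrtr_gt0. Qed.

Lemma quadric_dom y : b y y = - kappa -> E y -> D (C y).
Proof.
rewrite sprod_coord /D /= => qy Ey.
have -> : kappa + q (C y) = (sg * y 0 k) * (sg * y 0 k).
  rewrite mulrACA sg2 mul1r -[kappa]opprK -qy; ring.
exact: mulr_gt0.
Qed.

Lemma quadricK y : b y y = - kappa -> E y -> P (C y) = y.
Proof.
rewrite sprod_coord => qy Ey.
apply/rowP => i; rewrite mxE; case: unliftP => [j|] ->; first by rewrite mxE.
have -> : kappa + q (C y) = (sg * y 0 k) ^+ 2.
  rewrite expr2 mulrACA sg2 mul1r -[kappa]opprK -qy; ring.
by rewrite sqrtr_sqr ger0_norm ?ltW // mulrA sg2 mul1r.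
Qed.

Lemma q_Ck l U : open U -> Ck l U (fun u => kappa + q u).
Proof.
move=> oU; apply: (CkD oU (Ck_cst l U kappa)); apply: Ck_sum => // j.
by apply: (CkM oU (Ck_cst l U (sgnat n (lift k j) : R)));
  apply: (CkM oU); exact: Ck_coord.
Qed.

Lemma graph_dom_open : open D.
Proof.
apply: (@open_comp _ _ (fun u => kappa + q u) [set t | 0 < t]); last exact: open_gt.
by move=> u _; exact: (q_Ck 0 openT).
Qed.

Lemma graph_nbh_open : open E.
Proof.
apply: (@open_comp _ _ (fun y : 'rV[R]_m.+1 => sg * y 0 k) [set t | 0 < t]); last exact: open_gt.
move=> y _; apply: continuousM; first exact: cst_continuous.
exact: coord_continuous.
Qed.

Lemma graph_smooth : smooth_on D P.
Proof.
move=> l; apply: (Ck_row graph_dom_open) => i; under eq_fun do rewrite mxE.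
case: unliftP => [j|] _; first exact: Ck_coord.
apply: (CkM graph_dom_open (Ck_cst l D sg)).
by apply: (Ck_sqrt graph_dom_open) => //; exact: q_Ck graph_dom_open.
Qed.

Lemma graph_coo_smooth : smooth_on E C.
Proof.
move=> l; apply: (Ck_row graph_nbh_open) => j; under eq_fun do rewrite mxE.
exact: Ck_coord.
Qed.

Lemma graph_chart (S : set 'rV[R]_m.+1) :
  S `<=` [set y | b y y = - kappa] ->
  (forall y, b y y = - kappa -> 0 < sg * y 0 k -> S y) ->
  exists c : chart m S, nbh c = [set y | 0 < sg * y 0 k].
Proof.
move=> SQ QS.
have par_in u : D u -> (S `&` E) (P u).
  move=> Du; split; last exact: graph_side.
  by apply: QS; [exact: graph_quadric|exact: graph_side].
have coo_in y : (S `&` E) y -> D (C y) by move=> [/SQ Qy Ey]; exact: quadric_dom.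
have cooK y : (S `&` E) y -> P (C y) = y by move=> [/SQ Qy Ey]; exact: quadricK.
by exists (Chart graph_dom_open graph_nbh_open graph_smooth graph_coo_smooth
  par_in coo_in (fun u _ => graphK u) cooK).
Qed.

End GraphChart.

Lemma quadric_chart {R : realType} (n m N : nat) (kappa sg : R)
    (S : set 'rV[R]_N) (k : 'I_N) :
  N = m.+1 -> (n <= k)%N -> sg * sg = 1 ->
  S `<=` [set y | sprod n y y = - kappa] ->
  (forall y, sprod n y y = - kappa -> 0 < sg * y 0 k -> S y) ->
  exists c : chart m S, nbh c = [set y | 0 < sg * y 0 k].
Proof. by move=> hN; subst N => nk s2; exact: graph_chart. Qed.

(** * The index of the induced metric *)

Section Index.
Context {R : realType} {n m N : nat} (kappa : R) (S : set 'rV[R]_N).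
Context (k0 : 0 < kappa)
  (hS : S `<=` [set y | sprod n y y = - kappa]) (c : chart m S).
Local Notation G := (pullback_metric (sprod n) (par c)).
Local Notation b := (sprod n).

(** A subspace on which the metric is negative, together with the normal vector
    Y u, spans a subspace of the ambient space on which the form is negative;
    if its dimension exceeded q + 1, a nonzero vector in it would vanish in all
    the negative coordinates, of which there are at most q + 1. *)
Lemma index_le (q : nat) u (W : 'M[R]_m) : (N <= n + q.+1)%N -> dom c u ->
  negative_on (G u) W -> (\rank W <= q)%N.
Proof.
move=> Nn du negW; rewrite leqNgt; apply/negP => rW.
pose A := \matrix_i 'D_(frame i) (par c) u.
have AE v : v *m A = 'D_v (par c) u.
  rewrite (derive_frames v (par_diff du)) mulmx_sum_row.
  by apply: eq_bigr => i _; rewrite rowK.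
pose Z := col_mx (row_base W *m A) (par c u).
(* Projection on the coordinates of index at least n. *)
pose L : 'M[R]_(N, q.+1) := \matrix_(i, j) ((i : nat) == n + j)%N%:R.
have kerZ : kermx (Z *m L) != 0.
  rewrite -mxrank_eq0 -lt0n mxrank_ker subn_gt0.
  by apply: leq_ltn_trans (rank_leq_col _) _; rewrite addn1 ltnS.
have /rowV0Pn[w /sub_kermxP wZ wn0] := kerZ.
pose a := lsubmx w; pose t := rsubmx w 0 0; pose v := a *m row_base W.
have ZE : w *m Z = 'D_v (par c) u + t *: par c u.
  rewrite -[w]hsubmxK mul_row_col mulmxA AE; congr (_ + _).
  by rewrite [rsubmx w]mx11_scalar mul_scalar_mx.
have bZ0 : 0 <= b (w *m Z) (w *m Z).
  rewrite sprodE; apply: sumr_ge0 => i _; have [ni|ni] := ltnP i n.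
    by rewrite /sgnat ni mul1r -expr2 sqr_ge0.
  have lj : (i - n < q.+1)%N by rewrite ltn_subLR // (leq_trans (ltn_ord i)).
  have := congr1 (fun M : 'rV[R]_q.+1 => M 0 (Ordinal lj)) wZ.
  rewrite mulmxA mxE (bigD1 i) //= big1 => [|i' i'i].
    by rewrite !mxE /= subnKC // eqxx mulr1 addr0 => ->; rewrite !mulr0.
  by rewrite [L _ _]mxE /= subnKC // -val_eqE /= in i'i *; rewrite (negPf i'i) mulr0.
have bZE : b (w *m Z) (w *m Z) = qform (G u) v - t ^+ 2 * kappa.
  rewrite ZE sprodDl !sprodDr !sprodZl !sprodZr (sprodC _ (par c u)) (par_tangent hS) //.
  rewrite (par_quadric hS du) /qform (metric_mul n v v du); ring.
have vW : (v <= W)%MS by rewrite (submx_trans (submxMl _ _)) // eq_row_base.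
have [v0|vn0] := eqVneq v 0; last first.
  have := negW _ vW vn0; rewrite ltNge => /negP; apply.
  rewrite -(subrK (t ^+ 2 * kappa) (qform _ _)) -bZE addr_ge0 //.
  by rewrite mulr_ge0 ?sqr_ge0 // ltW.
have a0 : a = 0.
  by apply: (row_free_inj (row_base_free W)); rewrite mul0mx.
have t0 : t = 0.
  move: bZ0; rewrite bZE v0 /qform !mul0mx mxE sub0r oppr_ge0 pmulr_lle0 //.
  by move=> tt; apply/eqP; rewrite -sqrf_eq0 eq_le tt sqr_ge0.
move/negP: wn0; apply; apply/eqP.
rewrite -[w]hsubmxK -/a a0 [rsubmx w]mx11_scalar -/t t0.
by rewrite raddf0 row_mx0.
Qed.

End Index.

Section PositiveDefinite.
Context {R : realType} {n : nat}.
Implicit Types x y : 'rV[R]_(n + 1).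

Lemma sprod_euclidean (x : 'rV[R]_n) : 0 <= sprod n x x ?= iff (x == 0).
Proof.
have -> : sprod n x x = \sum_(i < n) x 0 i ^+ 2.
  by apply: eq_bigr => i _; rewrite ltn_ord expr2.
split; first by apply: sumr_ge0 => i _; exact: sqr_ge0.
rewrite eq_sym psumr_eq0 => [|i _]; last exact: sqr_ge0.
apply/allP/eqP => [x0|-> i _]; last by rewrite mxE expr0n eqxx.
apply/rowP => i; rewrite mxE; have := x0 i (mem_index_enum i).
by rewrite sqrf_eq0 => /eqP.
Qed.

(** The combination z of x and y without last coordinate has <z, z> >= 0, and
    <z, z> = t ^ 2 <x, x> + s ^ 2 <y, y>, where s and t are the last coordinates
    of x and y. *)
Lemma lorentz_orthogonal x y : sprod n y y < 0 -> sprod n x y = 0 -> x != 0 ->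
  0 < sprod n x x.
Proof.
move=> y0 xy xn0; pose s := x 0 (rshift n ord0); pose t := y 0 (rshift n ord0).
pose z := t *: x - s *: y.
have zE : z = row_mx (lsubmx z) 0.
  rewrite -[LHS]hsubmxK; congr row_mx; apply/rowP => i; rewrite ord1 !mxE.
  by rewrite -/s -/t mulrC subrr.
have zz : sprod n z z = sprod n (lsubmx z) (lsubmx z).
  rewrite zE sprod_row_mx // big1 ?subr0 ?row_mxKl // => i _.
  by rewrite mxE mul0r.
have zz' : sprod n z z = t ^+ 2 * sprod n x x + s ^+ 2 * sprod n y y.
  rewrite /z sprodBl !sprodBr !sprodZl !sprodZr (sprodC _ y x) xy; ring.
have [z0 zeq] := sprod_euclidean (lsubmx z).
rewrite ltNge; apply/negP => xx.
have sy : s ^+ 2 * sprod n y y <= 0 by rewrite mulr_ge0_le0 ?sqr_ge0 // ltW.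
have tx : t ^+ 2 * sprod n x x <= 0 by rewrite mulr_ge0_le0 ?sqr_ge0.
have zz0 : sprod n z z = 0.
  by apply/eqP; rewrite eq_le {2}zz z0 andbT zz'; lra.
have s0 : s = 0.
  have /eqP : s ^+ 2 * sprod n y y = 0.
    by apply/eqP; rewrite eq_le sy /=; move: zz'; rewrite zz0; lra.
  by rewrite mulf_eq0 (lt_eqF y0) orbF sqrf_eq0 => /eqP.
have zn : z = 0.
  rewrite zE; suff /eqP-> : lsubmx z == 0 by rewrite row_mx0.
  by rewrite -zeq eq_sym -zz zz0.
have t0 : t = 0.
  move/eqP: zn; rewrite /z s0 scale0r subr0 scaler_eq0 (negPf xn0) orbF.
  by move/eqP.
have : 0 <= sprod n y y.
  rewrite -[y]hsubmxK sprod_row_mx // big1 ?subr0.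
    by have [] := sprod_euclidean (lsubmx y).
  by move=> i _; rewrite ord1 mxE -/t t0 mul0r.
by rewrite leNgt y0.
Qed.

End PositiveDefinite.

(** * The hyperbolic space *)

Section HyperbolicSheet.
Context {R : realType} (n : nat) (r : R) (r0 : 0 < r).

Let lastc : 'I_(n + 1) := rshift n ord0.
Let Q : set 'rV[R]_(n + 1) := [set y | sprod n y y = - r ^+ 2].
Let base : 'rV[R]_(n + 1) := row_mx 0 (const_mx r).
Let H : set 'rV[R]_(n + 1) := connected_component Q base.

Lemma sprod_last (y : 'rV[R]_(n + 1)) :
  sprod n y y = sprod n (lsubmx y) (lsubmx y) - y 0 lastc ^+ 2.
Proof.
rewrite -{1 2}[y]hsubmxK sprod_row_mx ?leqnn // big_ord1 expr2.
by rewrite !mxE.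
Qed.

Lemma base_quadric : Q base.
Proof.
rewrite /Q /= sprod_last row_mxKl row_mxEr mxE.
by have [_] := sprod_euclidean (0 : 'rV[R]_n); rewrite eqxx => /eqP <-; rewrite sub0r.
Qed.

Lemma base_sheet : H base.
Proof. exact/connected_component_refl/base_quadric. Qed.

Lemma sheet_quadric : H `<=` Q.
Proof. exact: connected_component_sub. Qed.

(** The last coordinate does not vanish on the quadric, and it is positive at
    the base point. *)
Lemma sheet_pos y : H y -> 0 < y 0 lastc.
Proof.
move=> Hy; rewrite ltNge; apply/negP => y0.
have : connected [set z 0 lastc | z in H].
  apply: connected_continuous_connected; first exact: component_connected.
  by apply: continuous_subspaceT; exact: coord_continuous.
move=> /connected_intervalP itv.
have [|||z Hz z0] := itv (y 0 lastc) (base 0 lastc) _ _ 0.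
- by exists y.
- by exists base => //; exact: base_sheet.
- by rewrite y0 row_mxEr mxE ltW.
have := sheet_quadric Hz; rewrite /Q /= sprod_last z0 expr0n subr0 => E.
have [+ _] := sprod_euclidean (lsubmx z).
by rewrite E oppr_ge0 leNgt exprn_gt0.
Qed.

(** The point y = (y', s) is joined to the base point by the path
    t |-> (t y', sqrt (r ^ 2 + t ^ 2 |y'| ^ 2)). *)
Lemma sheet_upper y : Q y -> 0 < y 0 lastc -> H y.
Proof.
move=> Qy y0; pose e := sprod n (lsubmx y) (lsubmx y).
have [e0 _] := sprod_euclidean (lsubmx y).
have rad0 t : 0 < r ^+ 2 + t * t * e.
  by rewrite ltr_wpDr ?exprn_gt0 // mulr_ge0 // -expr2 sqr_ge0.
pose p (t : R) : 'rV[R]_(n + 1) :=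
  row_mx (t *: lsubmx y) (const_mx (Num.sqrt (r ^+ 2 + t * t * e))).
have pC k : Ck k setT (id : R -> R) -> Ck k setT p.
  move=> Cid; apply: (Ck_row openT) => j; under eq_fun do rewrite mxE.
  case: (fintype.split j) => [i|i].
    have -> : (fun t : R => (t *: lsubmx y) 0 i) = (fun t => t * lsubmx y 0 i).
      by apply/funext => t; rewrite mxE.
    by apply: (CkM openT Cid); exact: Ck_cst.
  have -> : (fun t : R => (const_mx (Num.sqrt (r ^+ 2 + t * t * e)) : 'rV[R]_1) 0 i)
      = (fun t => Num.sqrt (r ^+ 2 + t * t * e)) by apply/funext => t; rewrite mxE.
  apply: (Ck_sqrt openT) => //.
  apply: (CkD openT (Ck_cst k setT (r ^+ 2 : R))).
  by apply: (CkM openT (CkM openT Cid Cid)); exact: Ck_cst.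
have pc : continuous p by move=> t; apply: (pC 0%N) => // x _; exact: cvg_id.
have pQ t : Q (p t).
  rewrite /Q /= sprod_last row_mxKl row_mxEr mxE sqr_sqrtr ?ltW //.
  rewrite sprodZl sprodZr -/e; ring.
have p0 : p 0 = base by rewrite /p scale0r !mul0r addr0 sqrtr_sqr ger0_norm ?ltW.
have p1 : p 1 = y.
  rewrite -[RHS]hsubmxK /p scale1r; congr row_mx; apply/rowP => i.
  rewrite ord1 !mxE !mul1r.
  have -> : r ^+ 2 + e = y 0 lastc ^+ 2.
    by move: Qy; rewrite /Q /= sprod_last -/e => E; rewrite -[r ^+ 2]opprK -E; ring.
  by rewrite sqrtr_sqr ger0_norm // ltW.
apply: (@connected_component_max _ Q (p @` `[0, 1])).
- by exists 0 => //=; rewrite in_itv /= lexx ler01.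
- by move=> _ [t _ <-]; exact: pQ.
- apply: connected_continuous_connected; first exact: segment_connected.
  exact: continuous_subspaceT.
- by exists 1 => //=; rewrite in_itv /= lexx ler01.
Qed.

Lemma hyperbolic_submanifold : submanifold n (hyperbolic_space n r).
Proof.
move=> y Hy.
have [|||||c nE] := @quadric_chart R n n (n + 1) (r ^+ 2) 1 H lastc.
- by rewrite addn1.
- by rewrite /= addn0.
- by rewrite mulr1.
- exact: sheet_quadric.
- by move=> z Qz; rewrite mul1r; exact: sheet_upper.
by exists c; rewrite nE /= mul1r; exact: sheet_pos.
Qed.

Lemma hyperbolic_riemannian : pseudo_riemannian (hyperbolic_space n r) 0.
Proof.
have r20 : 0 < r ^+ 2 by rewrite exprn_gt0.
have n1 : (n + 1)%N = n.+1 by rewrite addn1.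
split; first exact: hyperbolic_submanifold.
move=> c u du; split; first exact: pullback_metric_sym.
  exact: (metric_unit n1 (lt0r_neq0 r20) sheet_quadric du).
split.
  exists 0; rewrite mxrank0; split=> // v; rewrite submx0 => /eqP -> /negP.
  by rewrite eqxx.
by move=> W; exact: (@index_le _ n n _ _ _ r20 sheet_quadric c 0 u W (leqnn _) du).
Qed.

Lemma hyperbolic_positive (c : chart n (hyperbolic_space n r)) u : dom c u ->
  positive_definite (metric c u).
Proof.
move=> du v v0; rewrite /qform (metric_mul n v v du).
apply: (@lorentz_orthogonal _ _ _ (par c u)).
- by rewrite (par_quadric sheet_quadric du) oppr_lt0 exprn_gt0.
- exact: (par_tangent sheet_quadric).
- apply: contraNneq v0 => v0; apply/eqP/(par_derive_inj du).
  by rewrite v0 derive0.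
Qed.

End HyperbolicSheet.

(** * The anti de Sitter space *)

Section AntiDeSitter.
Context {R : realType} (n : nat).
Local Notation N := (anti_de_sitter n).
Local Notation b := (sprod n).

Let dimN : (n + 1 + 1)%N = n.+2. Proof. by rewrite !addn1. Qed.
Let i0 : 'I_(n + 1 + 1) := lshift 1 (rshift n ord0).
Let i1 : 'I_(n + 1 + 1) := rshift (n + 1) ord0.

Lemma ads_quadric : carrier (anti_de_sitter (R := R) n) `<=` [set x | b x x = -1].
Proof. by []. Qed.

Lemma ads_coord (x : 'rV[R]_(n + 1 + 1)) :
  b x x = b (lsubmx (lsubmx x)) (lsubmx (lsubmx x)) - x 0 i0 ^+ 2 - x 0 i1 ^+ 2.
Proof.
rewrite -{1 2}[x]hsubmxK sprod_row_mx ?leq_addr // big_ord1 sprod_last.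
by rewrite !mxE -expr2.
Qed.

Lemma ads_submanifold : submanifold n.+1 (carrier (anti_de_sitter (R := R) n)).
Proof.
move=> x Nx.
have chart_at (i : 'I_(n + 1 + 1)) : (n <= i)%N -> x 0 i != 0 ->
    exists c : chart n.+1 (carrier (anti_de_sitter (R := R) n)), nbh c x.
  move=> ni xi; pose sg := Num.sg (x 0 i).
  have [|||c nE] := @quadric_chart R n n.+1 _ 1 sg N i dimN ni.
  - by rewrite /sg -expr2 sqr_sg xi.
  - exact: ads_quadric.
  - by [].
  by exists c; rewrite nE /= /sg -normrEsg normr_gt0.
have [x0|] := eqVneq (x 0 i0) 0; last by apply: chart_at; rewrite /= addn0.
apply: (chart_at i1); first by rewrite /= addn0 leq_addr.
apply: contraPneq Nx => x1 /=; rewrite ads_coord x0 x1 expr0n /= !subr0 => E.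
by have [+ _] := sprod_euclidean (lsubmx (lsubmx x)); rewrite E oppr_ge0 ler10.
Qed.

(** The negative direction at x = (x', a, b) is (0, - b, a), which is orthogonal
    to x. *)
Lemma ads_lorentzian : pseudo_riemannian (anti_de_sitter (R := R) n) 1.
Proof.
have one0 : (1 : R) != 0 by exact: oner_neq0.
split; first exact: ads_submanifold.
move=> c u du; split; first exact: pullback_metric_sym.
  exact: (metric_unit dimN one0 ads_quadric du).
split; last first.
  have n2 : (n + 1 + 1 <= n + 2)%N by rewrite -addnA.
  by move=> W; exact: (@index_le _ n _ _ _ _ ltr01 ads_quadric c 1 u W n2 du).
pose x := par c u; have bx : b x x = -1 by exact: (par_quadric (kappa := 1) ads_quadric du).
pose T : 'rV[R]_(n + 1 + 1) := row_mx (row_mx 0 (const_mx (- x 0 i1))) (const_mx (x 0 i0)).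
have bT y : b T y = x 0 i1 * y 0 i0 - x 0 i0 * y 0 i1.
  rewrite -{1}[y]hsubmxK -{1}[lsubmx y]hsubmxK !sprod_row_mx ?leq_addr // !big_ord1.
  rewrite sprodC -(scale0r 0) sprodZr mul0r !mxE; ring.
have Tx : b T x = 0 by rewrite bT; ring.
have TT : b T T < 0.
  rewrite bT; have [+ _] := sprod_euclidean (lsubmx (lsubmx x)).
  move: bx; rewrite ads_coord /T => E e0.
  rewrite row_mxEl row_mxEr row_mxEr !mxE; nra.
have [w wE] := tangent_space dimN one0 ads_quadric du Tx.
have wneq : w != 0.
  by apply: contraTneq TT => w0; rewrite wE w0 derive0 -(scale0r 0) sprodZl mul0r ltxx.
exists <<w>>%MS; split; last by rewrite genmxE rank_rV wneq.
move=> v; rewrite genmxE => /sub_rVP[a ->] v0.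
rewrite /qform (metric_mul n _ _ du) deriveZv; last exact: par_diff.
rewrite -wE sprodZl sprodZr mulrA pmulr_rlt0 // -expr2 exprn_even_gt0 //=.
by apply: contraNneq v0 => ->; rewrite scale0r.
Qed.

End AntiDeSitter.

(** * The embedding *)

Section Embedding.
Context {R : realType} (n : nat) (r : R) (r0 : 0 < r) (r2 : r ^+ 2 = 2^-1).

Let M := hyperbolic_space n r.
Let N := anti_de_sitter (R := R) n.
Let phi (y : 'rV[R]_(n + 1)) : 'rV[R]_(n + 1 + 1) := row_mx y (const_mx r).

Lemma phi_ads y : carrier M y -> carrier N (phi y).
Proof.
move=> /sheet_quadric; rewrite /N /= /phi sprod_row_mx ?leq_addr // big_ord1 !mxE => ->.
by rewrite -expr2 r2; field.
Qed.

Lemma phi_derive (c : chart n M) u v : dom c u ->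
  'D_v (phi \o par c) u = row_mx ('D_v (par c) u) 0.
Proof. by move=> du; exact/derive_row_mx/par_diff. Qed.

Lemma phi_isometry : isometric M N phi.
Proof.
move=> c u du; apply/matrixP => i j; rewrite !mxE !phi_derive // /= sprod_row_mx ?leq_addr //.
by rewrite big_ord1 !mxE mul0r subr0.
Qed.

Lemma phi_immersion : immersion M N phi.
Proof.
split; first split.
- exact: phi_ads.
- by move=> c k; apply: Ck_row_mx (open_dom (c:=c)) _; exact: par_smooth.
move=> c u du v v0; rewrite phi_derive //; apply: contraNneq v0 => E.
apply/eqP/(par_derive_inj du); rewrite derive0.
by have := congr1 lsubmx E; rewrite row_mxKl raddf0.
Qed.

(** Dropping the last coordinate is a continuous left inverse. *)
Lemma phi_embedding : embedding M N phi.
Proof.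
split; first exact: phi_immersion.
  by move=> x y _ _ /eq_row_mx[].
move=> A oA; exists (lsubmx @^-1` A).
  by apply: open_comp oA => x _; exact: continuous_lsubmx.
by congr (_ `&` _); apply/seteqP; split => y; rewrite /preimage /= row_mxKl.
Qed.

Lemma phi_spacelike : spacelike_hypersurface M N phi.
Proof.
split=> //.
- exact: hyperbolic_submanifold.
- exact: ads_lorentzian.
- exact: phi_immersion.
- by move=> c u du; rewrite phi_isometry //; exact: hyperbolic_positive.
Qed.

Let dimM : (n + 1)%N = n.+1. Proof. by rewrite addn1. Qed.
Let dimN : (n + 1 + 1)%N = n.+2. Proof. by rewrite !addn1. Qed.

Lemma phi_biharmonic : biharmonic M N phi.
Proof.
move=> c d u du nu.
exact: (bitension_eq0 dimM dimN (leq_addr _ _) r2 (sheet_quadric (r := r))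
  (ads_quadric (n := n)) phi_ads (conj du nu)).
Qed.

Lemma phi_not_harmonic : (0 < n)%N -> ~ Defs.harmonic M N phi.
Proof.
move=> n0 hphi.
have [c cb] := hyperbolic_submanifold r0 (base_sheet n r).
have [d db] := ads_submanifold (phi_ads (base_sheet n r)).
pose u := coo c (row_mx 0 (const_mx r)).
have du : dom c u by apply: coo_in; split => //; exact: base_sheet.
have uE : par c u = row_mx 0 (const_mx r) by apply: cooK; split => //; exact: base_sheet.
have nu : nbh d (phi (par c u)) by rewrite uE.
have := tension_neq0 dimM dimN (leq_addr _ _) r2 (sheet_quadric (r := r))
  (ads_quadric (n := n)) phi_ads n0 (conj du nu).
by move=> /eqP; apply; exact: hphi.
Qed.

End Embedding.

Theorem mainTheorem3 (R : realType) (n : nat) (hn : (1 <= n)%N) :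
  let r : R := 1 / Num.sqrt 2 in
  let M := hyperbolic_space n r in
  let N := anti_de_sitter n in
  let phi := fun y : 'rV[R]_(n + 1) => row_mx y (const_mx r) : 'rV[R]_(n + 1 + 1) in
  [/\ pseudo_riemannian M 0, embedding M N phi, isometric M N phi,
      spacelike_hypersurface M N phi & proper_biharmonic M N phi].
Proof.
move=> r M N phi.
have r0 : 0 < r by rewrite /r div1r invr_gt0 sqrtr_gt0.
have r2 : r ^+ 2 = 2^-1 by rewrite /r div1r exprVn sqr_sqrtr.
split.
- exact: hyperbolic_riemannian.
- exact: phi_embedding.
- exact: phi_isometry.
- exact: phi_spacelike.
- by split; [exact: phi_biharmonic|exact: phi_not_harmonic].
Qed.
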